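(* For the odd-cycle Gaussian problem with $0<D\le1$, the rate-distortion function is $R^{IG}(D)=\frac m4\log\frac1D$.
   Context: Odd-cycle Gaussian problem: $m\ge5$ odd; source $\mathbf{X}=(X_1,\dots,X_m)$ with independent $N(0,1)$ components, i.i.d. over time; decoder $i\in[m]$ has side information $\mathbf{Y_i}=(X_{i-1},X_{i+1})$ (indices mod $m$, taken in $[m]$) and must reconstruct $X_i$ with mean squared error $\frac1n\sum_{k=1}^nE[(X_{ik}-\widehat X_{ik})^2]\le D$. A code is an encoder of $\mathbf{X}^n$ into $\{1,\dots,M\}$ and decoders mapping (message, $\mathbf{Y_i}^n$) to $\widehat X_i^n$; $R$ is achievable if for every $\epsilon>0$ and all large $n$ there is a code with $\frac1n\log M\le R+\epsilon$ meeting distortion $D+\epsilon$ at every decoder; $R^{IG}(D)$ is the infimum of achievable rates (logarithms in the same base as the rate). *)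

(* Defs.v *)
From HB Require Import structures.
From mathcomp Require Import all_boot all_order all_algebra.
From mathcomp Require Import all_classical all_reals all_analysis.
Set Implicit Arguments. Unset Strict Implicit. Unset Printing Implicit Defensive.
Import Order.TTheory GRing.Theory Num.Theory.
Local Open Scope classical_set_scope.
Local Open Scope ring_scope.

Section OddCycle.
Context {R : realType} {d : measure_display} {T : measurableType d}.
Variable P : probability T R.

Definition mutually_independent {I : eqType} (Y : I -> T -> R) : Prop :=
  forall (s : seq I) (B : I -> set R), uniq s ->
    (forall i, measurable (B i)) ->
    P (\bigcap_(i in [set` s]) (Y i @^-1` B i)) =
    (\prod_(i <- s) P (Y i @^-1` B i))%E.

(* The source: X i k is component i (0-based, i < m) at time k. *)
Definition iid_std_gaussian_source (m : nat) (X : 'I_m -> nat -> T -> R) : Prop :=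
  (forall i k, measurable_fun setT (X i k)) /\
  (forall i k (A : set R), measurable A -> P (X i k @^-1` A) = normal_prob 0 1 A) /\
  mutually_independent (fun p : 'I_m * nat => X p.1 p.2).

Definition src_block m (X : 'I_m -> nat -> T -> R) (n : nat) (w : T)
  : n.-tuple (m.-tuple R) :=
  [tuple [tuple X i (val k) w | i < m] | k < n].

(* Side information of decoder i: (X_{i-1}^n, X_{i+1}^n), indices mod m. *)
Definition side_block m (X : 'I_m -> nat -> T -> R) (i : 'I_m) (n : nat) (w : T)
  : n.-tuple (R * R) :=
  [tuple (X (ord_pred i) (val k) w, X (ordS i) (val k) w) | k < n].

Definition mse m (X : 'I_m -> nat -> T -> R) (n M : nat)
  (enc : n.-tuple (m.-tuple R) -> 'I_M)
  (dec : 'I_m -> 'I_M -> n.-tuple (R * R) -> n.-tuple R) (i : 'I_m) : \bar R :=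
  ((n%:R)^-1)%:E *
  (\sum_(k < n) \int[P]_w
     ((X i (val k) w - tnth (dec i (enc (src_block X n w)) (side_block X i n w)) k) ^+ 2)%:E)%E.

Definition good_code m (X : 'I_m -> nat -> T -> R) (n : nat) (r D : R) : Prop :=
  exists (M : nat) (enc : n.-tuple (m.-tuple R) -> 'I_M)
         (dec : 'I_m -> 'I_M -> n.-tuple (R * R) -> n.-tuple R),
    (forall j : 'I_M, measurable (enc @^-1` [set j])) /\
    (forall (i : 'I_m) (j : 'I_M), measurable_fun setT (dec i j)) /\
    ln (M%:R) / n%:R <= r /\
    (forall i : 'I_m, (mse X enc dec i <= D%:E)%E).

Definition achievable m (X : 'I_m -> nat -> T -> R) (D r : R) : Prop :=
  forall eps : R, 0 < eps ->
    exists N : nat, forall n : nat, (N <= n)%N -> good_code X n (r + eps) (D + eps).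

Definition RIG m (X : 'I_m -> nat -> T -> R) (D : R) : R :=
  inf [set r : R | achievable X D r].

End OddCycle.

(* Main.v *)
Require Import Defs.
From HB Require Import structures.
From mathcomp Require Import all_boot all_order all_algebra.
From mathcomp Require Import all_classical all_reals all_analysis.
From mathcomp Require Import measurable_realfun charge normal_distribution.
From mathcomp Require Import ring lra zify.
Set Implicit Arguments. Unset Strict Implicit. Unset Printing Implicit Defensive.
Import Order.TTheory GRing.Theory Num.Theory.
Import numFieldNormedType.Exports.
Local Open Scope classical_set_scope.
Local Open Scope ring_scope.

(* Converse.  Fix a message j.  For each node i let G_i be the product over time of
   the densities, with respect to N(0, 1), of N(xhat, D) at the source symbols of
   node i, where xhat is what decoder i would output on message j.  As xhat only
   depends on the neighbours of i, G_i integrates to 1 in the variable of node i.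
   On an odd cycle with at least five nodes this forces the square of the product of
   the G_i to be a product of four functions that each have integral 1.  Summing
   over the M messages and using ln t <= t / M - 1 + ln M, one gets
   E [ln prod_i G_i] <= 2 ln M, while the distortion constraint makes the left-hand
   side at least (m n / 2) ln (1 / D).

   Achievability.  Quantize the two halves of each block with one good Gaussian
   quantizer with N + 1 cells, and send for each edge (i, i + 1) the sum modulo N + 1
   of the cell of the first half of X_i and the cell of the second half of X_{i+1}.
   Decoder i knows its neighbours, hence recovers both of its own cells.  This costs
   m / 2 times the rate (1/2) ln (1 / D) of the quantizer. *)

(** * Gaussian integrals *)

(** The obstacle is parity. For pairwise non-adjacent nodes the product of the G_i has integral 1,
    but an odd cycle has at most (m - 1) / 2 such nodes, and using them alone would give the
    constant (m - 1) / 4 in place of m / 4. So two of the four functions carry (m + 1) / 2 factors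
    each, some of them adjacent, and are divided by the average of one factor over a neighbouring
    variable. The other two carry (m - 1) / 2 factors each and are multiplied by these averages,
    which cancel in the product. Five nodes leave room for three consecutive nodes next to a path
    with two distinct ends.

    The same parity shapes the code: an odd cycle has no perfect matching, but giving every edge
    weight 1/2 covers every node exactly once, hence the half blocks.

    No entropy or mutual information is used: the converse is one pointwise inequality, arranged so
    that only nonnegative functions are integrated. *)

Section GaussianKernel.
Context {R : realType}.
Local Notation mu := (@lebesgue_measure R).
Local Notation gauss := (normal_prob (0 : R) 1).

(** The Radon-Nikodym derivative of the law agrees almost everywhere with [normal_pdf], since both
    give every measurable set the same mass. *)
Lemma integral_normal_prob (m s : R) (f : R -> \bar R) :
  measurable_fun [set: R] f -> (forall x, 0 <= f x)%E ->
  (\int[normal_prob m s]_x f x = \int[mu]_x (f x * (normal_pdf m s x)%:E))%E.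
Proof.
move=> mf f0.
have dom := @normal_prob_dominates R m s.
rewrite -(Radon_Nikodym_SigmaFinite.change_of_variables dom)//.
have mpdf : measurable_fun setT (EFin \o normal_pdf m s).
  by apply/measurable_EFinP; exact: measurable_normal_pdf.
apply: ae_eq_integral => //.
- apply: emeasurable_funM => //.
  exact: measurable_int (Radon_Nikodym_SigmaFinite.f_integrable dom).
- exact: emeasurable_funM.
- suff h : ae_eq mu setT (Radon_Nikodym_SigmaFinite.f (normal_prob m s) mu)
      (EFin \o normal_pdf m s) by apply: filterS h => x /= h /h ->.
  apply: integral_ae_eq => //.
  + exact: Radon_Nikodym_SigmaFinite.f_integrable.
  + by move=> E _ mE; rewrite -Radon_Nikodym_SigmaFinite.f_integral.
Qed.

(* The density of N(c, V) with respect to N(0, 1), for V > 0. *)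
Definition kap (V c x : R) : R :=
  (Num.sqrt V)^-1 * expR (- (x - c) ^+ 2 / (V *+ 2) + x ^+ 2 / 2).

Lemma kap_gt0 V c x : 0 < V -> 0 < kap V c x.
Proof. by move=> V0; rewrite mulr_gt0 ?expR_gt0// invr_gt0 sqrtr_gt0. Qed.

(** The bound is uniform in the centre [c]. A reconstruction is an arbitrary measurable function of
    the neighbours, so this uniformity is what keeps averages over a neighbour's variable finite. *)
Lemma kap_bound V c x : 0 < V -> kap V c x <= (Num.sqrt V)^-1 * expR (x ^+ 2 / 2).
Proof.
move=> V0; rewrite ler_pM2l ?invr_gt0 ?sqrtr_gt0// ler_expR gerDr mulNr oppr_le0.
by rewrite mulr_ge0 ?sqr_ge0// invr_ge0 mulrn_wge0// ltW.
Qed.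

Lemma ln_kap V c x : 0 < V ->
  ln (kap V c x) = ln V^-1 / 2 - (x - c) ^+ 2 / (V *+ 2) + x ^+ 2 / 2.
Proof.
move=> V0; rewrite lnM ?posrE ?expR_gt0 ?invr_gt0 ?sqrtr_gt0// expRK.
rewrite !lnV ?posrE ?sqrtr_gt0// -powR12_sqrt ?ltW// ln_powR.
by rewrite -mulr_natr; ring.
Qed.

Lemma measurable_kap V d (T : measurableType d) (f g : T -> R) :
  measurable_fun setT f -> measurable_fun setT g ->
  measurable_fun setT (fun w => kap V (f w) (g w)).
Proof.
move=> mf mg; apply: measurable_funM => //; apply: measurableT_comp => //.
apply: measurable_funD.
  apply: measurable_funM => //; apply: measurableT_comp => //.
  by apply: measurable_funX; exact: measurable_funB.
by apply: measurable_funM => //; exact: measurable_funX.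
Qed.

Lemma integral_kap V c : 0 < V -> (\int[gauss]_x (kap V c x)%:E = 1)%E.
Proof.
move=> V0; rewrite integral_normal_prob; last 2 first.
- by apply/measurable_EFinP; exact: measurable_kap.
- by move=> x; rewrite lee_fin ltW// kap_gt0.
rewrite -(integral_normal_pdf c (Num.sqrt V)); apply: eq_integral => x _.
have sV : Num.sqrt V != 0 by rewrite gt_eqF// sqrtr_gt0.
rewrite -EFinM; congr EFin.
rewrite !normal_pdfE ?oner_neq0// /normal_peak /normal_fun /kap.
rewrite sqr_sqrtr ?ltW// subr0 expr1n mul1r.
rewrite -mulrnAr sqrtrM ?ltW// invfM.
rewrite -!mulrA; congr (_ * _).
rewrite [LHS]mulrCA; congr (_ * _).
by rewrite -expRD; congr expR; rewrite !mulNr -mulr_natr; ring.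
Qed.

(* With correlation [al] the kernel is the bivariate density, hence symmetric. *)
Lemma kap_sym V al x z : 0 < V -> al ^+ 2 = 1 - V ->
  kap V (al * z) x = kap V (al * x) z.
Proof.
move=> V0 alE; congr (_ * expR _).
have -> : V = 1 - al ^+ 2 by rewrite alE; ring.
have : 1 - al ^+ 2 != 0 by rewrite alE; apply: lt0r_neq0; lra.
by move=> h; field.
Qed.

(** Exponential tilting: a quadratic weight turns the variance V into V u, up to the factor sqrt u.
    Writing the exponent as (1 - 1/u) / 2 makes it the optimal Chernoff parameter at level u. *)
Lemma expR_sqr_kap u c x : 0 < u -> forall V, 0 < V ->
  expR ((1 - u^-1) / 2 * ((x - c) ^+ 2 / V)) * kap V c x =
  Num.sqrt u * kap (V * u) c x.
Proof.
move=> u0 V V0; have su : Num.sqrt u != 0 by rewrite gt_eqF ?sqrtr_gt0.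
rewrite /kap sqrtrM ?ltW// invfM mulrCA -expRD.
transitivity ((Num.sqrt V)^-1 * expR (- (x - c) ^+ 2 / (V * u *+ 2) + x ^+ 2 / 2)).
  by congr (_ * expR _); field; rewrite !gt_eqF.
by field; rewrite su gt_eqF ?sqrtr_gt0.
Qed.

Lemma kap1 x : kap 1 0 x = 1.
Proof.
by rewrite /kap sqrtr1 invr1 mul1r subr0 mulNr addNr expR0.
Qed.

Lemma integral_expR_sqr u : 0 < u ->
  (\int[gauss]_x (expR ((1 - u^-1) / 2 * x ^+ 2))%:E = (Num.sqrt u)%:E)%E.
Proof.
move=> u0.
under eq_integral => x _.
  rewrite (_ : expR _ = Num.sqrt u * kap u 0 x); last first.
    by have := expR_sqr_kap 0 x u0 ltr01; rewrite subr0 divr1 kap1 mulr1 mul1r.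
  rewrite EFinM; over.
rewrite ge0_integralZl//=.
- by rewrite integral_kap// mule1.
- by apply/measurable_EFinP; exact: measurable_kap.
- by move=> x _; rewrite lee_fin ltW// kap_gt0.
Qed.

(* Comparing [1 + l x^2 <= exp(l x^2)] with the exact exponential moments, for
   small [l] of both signs, squeezes the second moment. *)
Lemma integral_sqr : (\int[gauss]_x (x ^+ 2)%:E = 1)%E.
Proof.
pose lam (r : R) := (1 - (r ^+ 2)^-1) / 2.
have msqr : measurable_fun [set: R] (fun x : R => (x ^+ 2)%:E).
  by apply/measurable_EFinP; exact: measurable_funX.
have mexp r : measurable_fun [set: R] (fun x : R => (expR (lam r * x ^+ 2))%:E).
  apply/measurable_EFinP; apply: measurableT_comp => //.
  by apply: measurable_funM => //; exact: measurable_funX.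
have sqr0 x : [set: R] x -> (0 <= (x ^+ 2)%:E)%E by move=> _; rewrite lee_fin sqr_ge0.
have exp0 r x : [set: R] x -> (0 <= (expR (lam r * x ^+ 2))%:E)%E.
  by move=> _; rewrite lee_fin expR_ge0.
have expE r : 0 < r -> (\int[gauss]_x (expR (lam r * x ^+ 2))%:E = r%:E)%E.
  move=> r0; rewrite integral_expR_sqr ?exprn_gt0//.
  by rewrite sqrtr_sqr ger0_norm// ltW.
have int1 : (\int[gauss]_x (1 : R)%:E = 1)%E.
  by rewrite integral_cst//= mul1e; exact: (@probability_setT _ _ _ gauss).
set S := (\int[gauss]_x (x ^+ 2)%:E)%E.
have S0 : (0 <= S)%E by exact: integral_ge0.
have le_pos r : 0 < r -> 0 <= lam r -> (1 + (lam r)%:E * S <= r%:E)%E.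
  move=> r0 l0; rewrite -(expE r)// -ge0_integralZl// -[X in (X + _)%E]int1.
  rewrite -ge0_integralD//.
  - apply: ge0_le_integral => //.
    + by move=> x _; rewrite -EFinM -EFinD lee_fin addr_ge0// mulr_ge0// sqr_ge0.
    + by apply: emeasurable_funD => //; exact: emeasurable_funM.
    + exact: mexp.
    + by move=> x _; rewrite -EFinM -EFinD lee_fin expR_ge1Dx.
  - by move=> x _; rewrite -EFinM lee_fin mulr_ge0// sqr_ge0.
  - exact: emeasurable_funM.
have le_neg r : 0 < r -> lam r <= 0 -> (1 <= r%:E + (- lam r)%:E * S)%E.
  rewrite -oppr_ge0 => r0 l0; rewrite -{1}(expE r)// -ge0_integralZl// -[X in (X <= _)%E]int1.
  rewrite -ge0_integralD//.
  - apply: ge0_le_integral => //.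
    + by apply: emeasurable_funD; [exact: mexp|exact: emeasurable_funM].
    + move=> x _; rewrite -EFinM -EFinD lee_fin mulNr lerBrDr.
      exact: expR_ge1Dx.
  - exact: mexp.
  - by move=> x _; rewrite -EFinM lee_fin mulr_ge0// sqr_ge0.
  - exact: emeasurable_funM.
have Sfin : S \is a fin_num.
  rewrite ge0_fin_numE//; rewrite ltNge leye_eq; apply/negP => /eqP Soo.
  have l2 : 0 < lam 2 by rewrite /lam; lra.
  by have := le_pos 2 (ltr0Sn _ 1) (ltW l2); rewrite Soo gt0_muley// addey.
rewrite -(fineK Sfin); congr EFin; set s := fine S.
have s0 : 0 <= s by exact: fine_ge0.
(* Testing at 1 + t, with t proportional to the deviation of [s] from 1, makes a single instance of
   the two inequalities enough: it reduces to t^2 (5 + 2 t) <= 0. *)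
pose t := (s - 1) / 4.
have sE : s = 1 + 4 * t by rewrite /t; field.
have r0 : 0 < 1 + t by rewrite /t; lra.
have : lam (1 + t) * s <= t.
  have [l0|/ltW l0] := leP 0 (lam (1 + t)).
    have := le_pos _ r0 l0; rewrite -(fineK Sfin) -/s -EFinM -EFinD lee_fin; lra.
  have := le_neg _ r0 l0; rewrite -(fineK Sfin) -/s -EFinM -EFinD lee_fin; lra.
have -> : lam (1 + t) * s = (2 * t + t ^+ 2) * s / (2 * (1 + t) ^+ 2).
  by rewrite /lam; field; rewrite gt_eqF.
rewrite ler_pdivrMr ?mulr_gt0 ?exprn_gt0//.
rewrite sE => h.
have {}h : t ^+ 2 * (5 + 2 * t) <= 0.
  rewrite (_ : _ * _ = (2 * t + t ^+ 2) * (1 + 4 * t) - t * (2 * (1 + t) ^+ 2)).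
    by rewrite subr_le0.
  by ring.
have t0 : t ^+ 2 <= 0.
  have t5 : 0 < 5 + 2 * t by move: r0; clear; lra.
  by rewrite -(pmulr_lle0 _ t5).
have /eqP : t ^+ 2 == 0 by rewrite eq_le t0 sqr_ge0.
by move/eqP; rewrite sqrf_eq0 => /eqP ->; rewrite mulr0 addr0.
Qed.

End GaussianKernel.

(** * Independent Gaussian coordinates *)

Lemma integral_gt0 d (T : measurableType d) (R : realType) (P : probability T R)
    (f : T -> \bar R) :
  measurable_fun setT f -> (forall x, 0 < f x)%E -> (0 < \int[P]_x f x)%E.
Proof.
move=> mf f0; rewrite lt_neqAle integral_ge0 ?andbT; last by move=> x _; exact: ltW.
apply/eqP => /esym h.
have [] : ae_eq P setT f (cst 0%E).
  by apply/ae_eq_integral_abs => //; under eq_integral do rewrite gee0_abs ?ltW//.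
move=> A [mA A0 sA].
have AT : A = setT.
  apply/seteqP; split => // y _; apply: sA => /= /(_ Logic.I) /eqP.
  by rewrite gt_eqF.
have /eqP : P setT = 0%E by rewrite -AT.
by rewrite probability_setT onee_eq0.
Qed.

Section Coordinates.
Context {R : realType} {I : finType}.
Local Notation Om := (#|I|.-tuple R).
Local Notation gauss := (normal_prob (0 : R) 1).

(** Tuples carry the product sigma-algebra; [co] and [tup] translate between their positions and the
    elements of an arbitrary finite index type. *)
Definition co (x : Om) (p : I) : R := tnth x (enum_rank p).
Definition tup (f : I -> R) : Om := [tuple f (enum_val i) | i < #|I|].

Lemma co_tup f p : co (tup f) p = f p.
Proof. by rewrite /co tnth_mktuple enum_rankK. Qed.

Lemma co_inj x y : co x =1 co y -> x = y.
Proof.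
move=> xy; apply: eq_from_tnth => i.
by have := xy (enum_val i); rewrite /co enum_valK.
Qed.

Lemma measurable_co p : measurable_fun [set: Om] (co^~ p).
Proof. exact: measurable_tnth. Qed.

Lemma measurable_tup d (T : measurableType d) (F : I -> T -> R) :
  (forall p, measurable_fun setT (F p)) ->
  measurable_fun setT (fun w => tup (F^~ w)).
Proof.
move=> mF; apply/measurable_fun_tnthP => i.
by rewrite (_ : _ \o _ = F (enum_val i))//; apply/funext => w /=; rewrite tnth_mktuple.
Qed.

Definition rect (B : I -> set R) : set Om := [set x | forall p, B p (co x p)].

Lemma measurable_rect B : (forall p, measurable (B p)) -> measurable (rect B).
Proof.
move=> mB.
rewrite (_ : rect B = \bigcap_(p in [set` enum I]) (co^~ p @^-1` B p)).
  apply: fin_bigcap_measurable => // p _.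
  by rewrite -[X in measurable X]setTI; exact: measurable_co.
apply/seteqP; split => x /= Bx p; first by move=> _; exact: Bx.
by apply: Bx; rewrite /= mem_enum.
Qed.

(** Rectangles are stable under intersection and generate the product sigma-algebra. *)
Lemma rect_unique (m1 m2 : {measure set Om -> \bar R}) : (m1 setT < +oo)%E ->
  (forall B, (forall p, measurable (B p)) -> m1 (rect B) = m2 (rect B)) ->
  forall A, measurable A -> m1 A = m2 A.
Proof.
move=> foo m12.
pose G : set (set Om) := [set A | exists2 B, (forall p, measurable (B p)) & A = rect B].
have GT : G setT.
  by exists (fun=> setT) => //; apply/seteqP; split.
apply: (measure_unique G (fun=> setT)) => //.
- apply/seteqP; split.
    apply: smallest_sub; first exact: smallest_sigma_algebra.
    rewrite -bigcup_seq; apply: bigcup_sub => i _ _ [A mA <-].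
    apply: sub_sigma_algebra.
    exists (fun p => if p == enum_val i then A else setT).
      by move=> p; case: ifP.
    apply/seteqP; split => x /=.
      by case=> _ xA p; case: ifP => // /eqP ->; rewrite /co enum_valK.
    by move=> /(_ (enum_val i)); rewrite eqxx /co enum_valK.
  apply: smallest_sub; first exact: sigma_algebra_measurable.
  by move=> _ [B mB ->]; exact: measurable_rect.
- move=> _ _ [B1 mB1 ->] [B2 mB2 ->]; exists (fun p => B1 p `&` B2 p).
    by move=> p; exact: measurableI.
  apply/seteqP; split => x /=; first by move=> [x1 x2] p; split.
  by move=> x12; split => p; have [] := x12 p.
- by rewrite bigcup_const.
- by move=> _ [B mB ->]; exact: m12.
Qed.

(** The standard Gaussian law on the coordinates, prescribed only on rectangles: by [rect_unique]
    this determines it, and no iterated product measure has to be handled. *)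
Definition gaussian (mu : set Om -> \bar R) :=
  forall B, (forall p, measurable (B p)) -> mu (rect B) = (\prod_p gauss (B p))%E.

Variable mu : probability Om R.
Hypothesis gmu : gaussian mu.

(** Serves two maps: the resampling [mix] on a product of two copies, and the map sending a point of
    the source's probability space to finitely many source symbols. *)
Lemma gaussian_law d (T : measurableType d) (m : {measure set T -> \bar R})
    (F : T -> Om) (f : Om -> \bar R) :
  measurable_fun setT F ->
  (forall B, (forall p, measurable (B p)) ->
     m (F @^-1` rect B) = (\prod_p gauss (B p))%E) ->
  measurable_fun setT f -> (forall x, 0 <= f x)%E ->
  (\int[mu]_x f x = \int[m]_w f (F w))%E.
Proof.
move=> mF mB mf f0.
have := @ge0_integral_pushforward _ _ _ _ _ _ mF m setT f measurableT mf.
rewrite preimage_setT => <-; last by move=> x _; exact: f0.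
apply: eq_measure_integral => A mA _; apply: rect_unique mA.
  by have h : (mu setT < +oo)%E; [rewrite probability_setT ltry|exact: h].
by move=> B HB; apply: etrans (gmu HB) _; exact/esym/mB.
Qed.

Definition mix (S : pred I) (x y : Om) : Om :=
  tup (fun p => if S p then co y p else co x p).

Lemma co_mix S x y p : co (mix S x y) p = if S p then co y p else co x p.
Proof. by rewrite co_tup. Qed.

Lemma measurable_mix S : measurable_fun setT (fun z : Om * Om => mix S z.1 z.2).
Proof.
apply: (measurable_tup (F := fun p z => if S p then co z.2 p else co z.1 p)) => p.
case: (S p).
  exact: (measurableT_comp (measurable_co p) measurable_snd).
exact: (measurableT_comp (measurable_co p) measurable_fst).
Qed.

Lemma measurable_mix2 S x : measurable_fun setT (mix S x).
Proof.
apply: (measurable_tup (F := fun p y => if S p then co y p else co x p)) => p.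
by case: (S p) => //; exact: measurable_co.
Qed.

(** Replacing the coordinates in [S] by an independent copy does not change the law. This plays the
    part of Fubini for integrating over some coordinates with the others frozen, without splitting
    the tuple type. *)
Lemma integral_mix S (f : Om -> \bar R) :
  measurable_fun setT f -> (forall x, 0 <= f x)%E ->
  (\int[mu]_x f x = \int[mu]_x \int[mu]_y f (mix S x y))%E.
Proof.
move=> mf f0.
have mF := measurable_mix S.
rewrite -(fubini_tonelli1 (fun z : Om * Om => f (mix S z.1 z.2)))//=; last first.
  by apply: measurableT_comp.
apply: gaussian_law => // B mB.
pose B1 p := if S p then setT else B p.
pose B2 p := if S p then B p else setT.
have mB1 p : measurable (B1 p) by rewrite /B1; case: ifP.
have mB2 p : measurable (B2 p) by rewrite /B2; case: ifP.
transitivity ((mu \x mu)%E (rect B1 `*` rect B2)).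
  congr ((mu \x mu)%E _); apply/seteqP; split => -[x y] /=.
    move=> xyB; split => p; have := xyB p; rewrite co_mix /B1 /B2 /=;
    by case: ifP.
  by move=> [x1 y2] p; rewrite co_mix; have := x1 p; have := y2 p; rewrite /B1 /B2; case: ifP.
transitivity (mu (rect B1) * mu (rect B2))%E.
  exact: product_measure1E (measurable_rect mB1) (measurable_rect mB2).
rewrite !gmu// -big_split/=; apply: eq_bigr => p _.
rewrite /B1 /B2; case: ifP => _.
  by rewrite (@probability_setT _ _ _ gauss) mul1e.
by rewrite (@probability_setT _ _ _ gauss) mule1.
Qed.

Lemma integral_co p (f : R -> \bar R) :
  measurable_fun [set: R] f -> (forall x, 0 <= f x)%E ->
  (\int[mu]_x f (co x p) = \int[gauss]_t f t)%E.
Proof.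
move=> mf f0.
have mc : measurable_fun [set: Om] ((co^~ p) : Om -> measurableTypeR R).
  exact: measurable_co.
have := @ge0_integral_pushforward _ _ _ (measurableTypeR R) _ _ mc mu setT f measurableT mf.
rewrite preimage_setT => <-; last by move=> x _; exact: f0.
apply: eq_measure_integral => A mA _.
transitivity (mu (rect (fun q => if q == p then A else setT))).
  congr (mu _); apply/seteqP; split => x /=.
    by move=> xA q; case: ifP => // /eqP ->.
  by move=> /(_ p); rewrite eqxx.
rewrite gmu; last by move=> q; case: ifP.
rewrite (bigD1 p)//= eqxx big1 ?mule1// => q /negbTE ->.
exact: probability_setT.
Qed.

(** Independence of the coordinates, by resampling one coordinate at a time: the other factors do
    not see it. *)
Lemma integral_prod_co (f : I -> R -> \bar R) :
  (forall p, measurable_fun [set: R] (f p)) -> (forall p x, 0 <= f p x)%E ->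
  (\int[mu]_x (\prod_p f p (co x p)) = \prod_p \int[gauss]_t f p t)%E.
Proof.
move=> mf f0.
have mfc p : measurable_fun setT (fun x => f p (co x p)).
  by apply: measurableT_comp => //; exact: measurable_co.
have E (F : I -> \bar R) : (\prod_p F p = \prod_(p <- enum I) F p)%E by rewrite big_enum.
rewrite E; under eq_integral do rewrite E.
elim: (enum I) (enum_uniq I) => [_|p s IH].
  under eq_integral do rewrite big_nil.
  by rewrite big_nil integral_cst//= mul1e; exact: probability_setT.
rewrite cons_uniq => /andP[ps us].
have mprod r : measurable_fun setT (fun x => \prod_(q <- r) f q (co x q))%E.
  elim: r => [|q r IHr].
    under eq_fun do rewrite big_nil.
    exact: measurable_cst.
  under eq_fun do rewrite big_cons.
  by apply: emeasurable_funM; [exact: mfc|exact: IHr].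
have prod0 r x : (0 <= \prod_(q <- r) f q (co x q))%E.
  by elim/big_ind : _ => // a b; exact: mule_ge0.
under eq_integral do rewrite big_cons.
rewrite big_cons -IH// -(integral_co p (mf p) (f0 p)).
rewrite [LHS](integral_mix (pred1 p)); last 2 first.
- by apply: emeasurable_funM; [exact: mfc|exact: mprod].
- by move=> x; rewrite mule_ge0.
transitivity (\int[mu]_x \int[mu]_y (f p (co y p) * \prod_(q <- s) f q (co x q)))%E.
  apply: eq_integral => x _; apply: eq_integral => y _.
  rewrite co_mix /= eqxx; congr (_ * _)%E; apply: eq_big_seq => q qs.
  by rewrite co_mix /= ifN//; apply: contraNneq ps => <-.
transitivity (\int[mu]_x ((\int[mu]_y f p (co y p)) * \prod_(q <- s) f q (co x q)))%E.
  by apply: eq_integral => x _; rewrite ge0_integralZr.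
rewrite ge0_integralZl//.
exact: integral_ge0.
Qed.

End Coordinates.

(** * The odd cycle inequality *)

Section CycleCore.
Context {R : realType} {I : finType}.
Local Notation Om := (#|I|.-tuple R).
Variable mu : probability Om R.
Hypothesis gmu : gaussian mu.
Variable blk : I -> nat.

Definition mixb (c : nat) : Om -> Om -> Om := mix (fun p => blk p == c).
(** Not depending on block [c] is phrased as invariance under resampling that block, so that it
    combines with [integral_mix] by rewriting. *)
Definition ind (c : nat) (h : Om -> R) := forall x y, h (mixb c x y) = h x.

Lemma mixb_mixb c x y z : mixb c (mixb c x y) z = mixb c x z.
Proof. by apply: co_inj => p; rewrite !co_mix; case: (_ == _). Qed.

Lemma mixbC c c' x y z : c != c' ->
  mixb c (mixb c' x y) z = mixb c' (mixb c x z) y.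
Proof.
move=> cc'; apply: co_inj => p; rewrite !co_mix.
by have [->|//] := eqVneq (blk p) c; rewrite (negbTE cc').
Qed.

Lemma indM c f g : ind c f -> ind c g -> ind c (fun x => f x * g x).
Proof. by move=> fc gc x y; rewrite fc gc. Qed.

Lemma indV c f : ind c f -> ind c (fun x => (f x)^-1).
Proof. by move=> fc x y; rewrite fc. Qed.

Lemma ind_prod c (s : seq nat) (g : nat -> Om -> R) :
  (forall i, i \in s -> ind c (g i)) -> ind c (fun x => \prod_(i <- s) g i x).
Proof. by move=> gc x y; apply: eq_big_seq => i /gc ->. Qed.

(** The conditional expectation given all blocks but [c], made real by [fine]; its properties below
    assume that the inner integral is finite. *)
Definition avg (c : nat) (g : Om -> R) (x : Om) : R :=
  fine (\int[mu]_y (g (mixb c x y))%:E).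

Lemma ind_avg c g : ind c (avg c g).
Proof.
by move=> x y; congr fine; apply: eq_integral => z _; rewrite mixb_mixb.
Qed.

Lemma ind_avgC c c' g : c != c' -> ind c' g -> ind c' (avg c g).
Proof.
move=> cc' gc x y; congr fine; apply: eq_integral => z _.
by rewrite mixbC// gc.
Qed.

Section Averaging.
Variables (c : nat) (g : Om -> R).
Hypothesis mg : measurable_fun setT g.
Hypothesis g0 : forall x, 0 < g x.
Hypothesis gfin : forall x, (\int[mu]_y (g (mixb c x y))%:E < +oo)%E.

Let mgmix : measurable_fun setT (fun z : Om * Om => (g (mixb c z.1 z.2))%:E).
Proof.
apply/measurable_EFinP; apply: measurableT_comp => //; exact: measurable_mix.
Qed.

Lemma avgE x : ((avg c g x)%:E = \int[mu]_y (g (mixb c x y))%:E)%E.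
Proof.
rewrite fineK// ge0_fin_numE//; apply: integral_ge0 => y _.
by rewrite lee_fin ltW.
Qed.

Lemma avg_gt0 x : 0 < avg c g x.
Proof.
rewrite -lte_fin avgE; apply: integral_gt0 => [|y]; last by rewrite lte_fin.
apply/measurable_EFinP; apply: measurableT_comp => //; exact: measurable_mix2.
Qed.

Lemma measurable_avg : measurable_fun setT (avg c g).
Proof.
apply: (measurableT_comp (fine_measurable measurableT)) => //.
apply: (measurable_fun_fubini_tonelli_F (m2 := mu)
  (fun z : Om * Om => (g (mixb c z.1 z.2))%:E)) => //.
by move=> z; rewrite lee_fin ltW.
Qed.

(** The defining property of conditional expectation: a factor [h] not involving block [c] goes
    through the inner integral. *)
Lemma integral_avg (h : Om -> R) : measurable_fun setT h -> (forall x, 0 <= h x) -> ind c h ->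
  (\int[mu]_x (h x * g x)%:E = \int[mu]_x (h x * avg c g x)%:E)%E.
Proof.
move=> mh h0 hc; rewrite (integral_mix gmu (fun p => blk p == c)); last 2 first.
- by apply/measurable_EFinP; exact: measurable_funM.
- by move=> x; rewrite lee_fin mulr_ge0// ltW.
apply: eq_integral => x _.
under eq_integral => y _ do rewrite -/(mixb c x y) hc EFinM.
rewrite ge0_integralZl//.
- by rewrite EFinM avgE.
- apply/measurable_EFinP; apply: measurableT_comp => //; exact: measurable_mix2.
- by move=> y _; rewrite lee_fin ltW.
- by rewrite lee_fin.
Qed.

End Averaging.

Variables (K : nat) (G : nat -> Om -> R).
Let m := K.*2.+1.+4.

(** Distance at least two on the cycle with [m] nodes; the last two conjuncts account for the edge
    that closes it, between 0 and [K.*2.+4]. *)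
Let far (i c : nat) := [&& i != c, i.+1 != c, c.+1 != i,
  ~~ ((i == 0)%N && (c == K.*2.+4)) & ~~ ((c == 0)%N && (i == K.*2.+4))].

Hypothesis mG : forall i, measurable_fun setT (G i).
Hypothesis G0 : forall i x, 0 < G i x.
Hypothesis G1 : forall i x, (\int[mu]_y (G i (mixb i x y))%:E = 1)%E.
Hypothesis Gind : forall i c, (i < m)%N -> (c < m)%N -> far i c -> ind c (G i).
Hypothesis Gfin : forall i c x, c != i -> (\int[mu]_y (G i (mixb c x y))%:E < +oo)%E.

Lemma integral_peel i (h : Om -> R) : measurable_fun setT h -> (forall x, 0 <= h x) -> ind i h ->
  (\int[mu]_x (h x * G i x)%:E = \int[mu]_x (h x)%:E)%E.
Proof.
move=> mh h0 hi; rewrite (integral_avg (c := i))//; last first.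
  by move=> x; rewrite G1 ltry.
by apply: eq_integral => x _; rewrite /avg G1 mulr1.
Qed.

Lemma measurable_prodG (s : seq nat) : measurable_fun setT (fun x => \prod_(i <- s) G i x).
Proof. by apply: measurable_prod => i _. Qed.

Lemma prodG_gt0 (s : seq nat) x : 0 < \prod_(i <- s) G i x.
Proof. by apply: prodr_gt0. Qed.

(** For pairwise non-adjacent nodes, the variable of each one occurs in its own factor only, so the
    factors integrate out one by one. *)
Lemma integral_peels (s : seq nat) (h : Om -> R) : measurable_fun setT h -> (forall x, 0 <= h x) ->
  uniq s -> (forall i, i \in s -> (i < m)%N /\ ind i h) ->
  (forall i c, i \in s -> c \in s -> i != c -> far i c) ->
  (\int[mu]_x (h x * \prod_(i <- s) G i x)%:E = \int[mu]_x (h x)%:E)%E.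
Proof.
move=> mh h0; elim: s => [|i s IH] /=.
  by move=> _ _ _; apply: eq_integral => x _; rewrite big_nil mulr1.
move=> /andP[si us] hs fs.
transitivity (\int[mu]_x ((h x * \prod_(j <- s) G j x) * G i x)%:E)%E.
  by apply: eq_integral => x _; rewrite big_cons mulrCA mulrC.
rewrite integral_peel.
- apply: IH => // j; first by move=> js; apply: hs; rewrite inE js orbT.
  by move=> c js cs; apply: fs; rewrite inE ?js ?cs orbT.
- by apply: measurable_funM => //; exact: measurable_prodG.
- by move=> x; rewrite mulr_ge0// ltW// prodG_gt0.
- have [im hi] : (i < m)%N /\ ind i h by apply: hs; rewrite mem_head.
  apply: indM => //; apply: ind_prod => j js; apply: Gind => //.
    by have [] := hs j; rewrite ?inE ?js ?orbT.
  apply: fs; rewrite ?mem_head// ?inE ?js ?orbT//.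
  by apply: contraNneq si => <-.
Qed.

Let sO := [seq j.*2.+3 | j <- iota 0 K].
Let sE := [seq j.*2.+2 | j <- iota 0 K].
Let rO x := \prod_(i <- sO) G i x.
Let rE x := \prod_(i <- sE) G i x.

Let sOP i : i \in sO -> exists2 j, (j < K)%N & i = j.*2.+3.
Proof. by move=> /mapP[j]; rewrite mem_iota /= add0n => jK ->; exists j. Qed.

Let sEP i : i \in sE -> exists2 j, (j < K)%N & i = j.*2.+2.
Proof. by move=> /mapP[j]; rewrite mem_iota /= add0n => jK ->; exists j. Qed.

Let uniqO : uniq (1%N :: sO).
Proof.
rewrite /= map_inj_uniq ?iota_uniq ?andbT; last by move=> a b []; lia.
by apply/negP => /sOP[j _]; lia.
Qed.

Let uniqE : uniq (K.*2.+2 :: sE).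
Proof.
rewrite /= map_inj_uniq ?iota_uniq ?andbT; last by move=> a b []; lia.
by apply/negP => /sEP[j]; lia.
Qed.

Let a := avg 0 (G 1).
Let b := avg K.*2.+3 (G K.*2.+2).

Let afin x : (\int[mu]_y (G 1 (mixb 0 x y))%:E < +oo)%E.
Proof. exact: Gfin. Qed.
Let bfin x : (\int[mu]_y (G K.*2.+2 (mixb K.*2.+3 x y))%:E < +oo)%E.
Proof. by apply: Gfin; lia. Qed.
Let a0 x : 0 < a x. Proof. exact: avg_gt0. Qed.
Let b0 x : 0 < b x. Proof. exact: avg_gt0. Qed.
Let ma : measurable_fun setT a. Proof. exact: measurable_avg. Qed.
Let mb : measurable_fun setT b. Proof. exact: measurable_avg. Qed.
Let mrO : measurable_fun setT rO. Proof. exact: measurable_prodG. Qed.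
Let mrE : measurable_fun setT rE. Proof. exact: measurable_prodG. Qed.
Let rO0 x : 0 < rO x. Proof. exact: prodG_gt0. Qed.
Let rE0 x : 0 < rE x. Proof. exact: prodG_gt0. Qed.

Let inda c : c \in [:: 0; K.*2.+3; K.*2.+4]%N -> ind c a.
Proof.
rewrite !inE => /or3P[]/eqP ->; first exact: ind_avg.
  by apply: ind_avgC => //; apply: Gind; rewrite /far; lia.
by apply: ind_avgC => //; apply: Gind; rewrite /far; lia.
Qed.

Let indb c : c \in [:: 0; K.*2.+3; K.*2.+4]%N -> ind c b.
Proof.
rewrite !inE => /or3P[]/eqP ->; last 2 first.
- exact: ind_avg.
- by apply: ind_avgC; [lia|apply: Gind; rewrite /far; lia].
by apply: ind_avgC => //; apply: Gind; rewrite /far; lia.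
Qed.

Let indrO c : c \in [:: 0; K.*2.+3; K.*2.+4]%N -> ind c rO.
Proof.
move=> cs; apply: ind_prod => i /sOP[j jK ->].
by move: cs; rewrite !inE => /or3P[]/eqP ->; apply: Gind; rewrite /far; lia.
Qed.

Let indrE c : c \in [:: 0; K.*2.+3; K.*2.+4]%N -> ind c rE.
Proof.
move=> cs; apply: ind_prod => i /sEP[j jK ->].
by move: cs; rewrite !inE => /or3P[]/eqP ->; apply: Gind; rewrite /far; lia.
Qed.

Let int1 : (\int[mu]_x (1 : R)%:E = 1)%E.
Proof. by rewrite integral_cst//= mul1e; exact: probability_setT. Qed.

Let integral_rO : (\int[mu]_x (rO x * G 1 x)%:E = 1)%E.
Proof.
transitivity (\int[mu]_x (1 * \prod_(i <- 1%N :: sO) G i x)%:E)%E.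
  by apply: eq_integral => x _; rewrite big_cons mul1r mulrC.
rewrite integral_peels ?int1//.
- move=> i; rewrite inE => /orP[/eqP ->|/sOP[j jK ->]]; split => //; lia.
- move=> i c; rewrite !inE.
  by move=> /orP[/eqP ->|/sOP[j jK ->]] /orP[/eqP ->|/sOP[j' jK' ->]]; rewrite /far; lia.
Qed.

Let integral_rE : (\int[mu]_x (rE x * G K.*2.+2 x)%:E = 1)%E.
Proof.
transitivity (\int[mu]_x (1 * \prod_(i <- K.*2.+2 :: sE) G i x)%:E)%E.
  by apply: eq_integral => x _; rewrite big_cons mul1r mulrC.
rewrite integral_peels ?int1//.
- move=> i; rewrite inE => /orP[/eqP ->|/sEP[j jK ->]]; split => //; lia.
- move=> i c; rewrite !inE.
  by move=> /orP[/eqP ->|/sEP[j jK ->]] /orP[/eqP ->|/sEP[j' jK' ->]]; rewrite /far; lia.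
Qed.

(* The nodes 0, K.*2.+3 and K.*2.+4 are consecutive; the others form a path, split
   into the odd nodes [1 :: sO] and the even nodes [K.*2.+2 :: sE].  Each of the four
   functions below is integrated by removing one after the other factors whose
   variable does not occur in the rest; [a] and [b] are the averages of the two end
   factors [G 1] and [G K.*2.+2] of the path over their neighbour outside it. *)
Let T1 x := rO x * a x * (G 0 x * G K.*2.+3 x).
Let T2 x := rE x * b x * (G 0 x * G K.*2.+3 x).
Let T3 x := rO x * (b x)^-1 * G 1 x * G K.*2.+2 x * G K.*2.+4 x.
Let T4 x := rE x * (a x)^-1 * G K.*2.+2 x * G 1 x * G K.*2.+4 x.

Let peel2 (h : Om -> R) : measurable_fun setT h -> (forall x, 0 <= h x) ->
  ind 0 h -> ind K.*2.+3 h ->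
  (\int[mu]_x (h x * (G 0 x * G K.*2.+3 x))%:E = \int[mu]_x (h x)%:E)%E.
Proof.
move=> mh h0 hi hi'.
transitivity (\int[mu]_x (h x * \prod_(i <- [:: 0; K.*2.+3]%N) G i x)%:E)%E.
  by apply: eq_integral => x _; rewrite !big_cons big_nil mulr1.
apply: integral_peels => //.
- by move=> i; rewrite !inE => /orP[]/eqP ->; split => //; lia.
- by move=> i c; rewrite !inE => /orP[]/eqP -> /orP[]/eqP ->; rewrite /far; lia.
Qed.

Let integral_T1 : (\int[mu]_x (T1 x)%:E = 1)%E.
Proof.
rewrite peel2.
- rewrite -integral_avg ?integral_rO//; first by move=> x; exact: ltW.
  by apply: indrO; rewrite inE.
- exact: measurable_funM.
- by move=> x; rewrite mulr_ge0// ltW.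
- by apply: indM; [apply: indrO|apply: inda]; rewrite inE.
- by apply: indM; [apply: indrO|apply: inda]; rewrite !inE eqxx orbT.
Qed.

Let integral_T2 : (\int[mu]_x (T2 x)%:E = 1)%E.
Proof.
rewrite peel2.
- rewrite -integral_avg ?integral_rE//; first by move=> x; exact: ltW.
  by apply: indrE; rewrite !inE eqxx orbT.
- exact: measurable_funM.
- by move=> x; rewrite mulr_ge0// ltW.
- by apply: indM; [apply: indrE|apply: indb]; rewrite inE.
- by apply: indM; [apply: indrE|apply: indb]; rewrite !inE eqxx orbT.
Qed.

Let mV (f : Om -> R) : measurable_fun setT f -> (forall x, 0 < f x) ->
  measurable_fun [set: Om] (fun x => (f x)^-1).
Proof.
move=> mf f0.
rewrite (_ : (fun _ => _) = expR \o (-%R \o (@ln R \o f))).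
  by apply: measurableT_comp => //; apply: measurableT_comp => //; exact: measurableT_comp.
by apply/funext => x /=; rewrite expRN lnK// posrE.
Qed.

Let integral_T3 : (\int[mu]_x (T3 x)%:E = 1)%E.
Proof.
have mbV := mV mb b0.
have V0 x : 0 <= (b x)^-1 by rewrite invr_ge0 ltW.
have m1 : measurable_fun setT (fun x => rO x * (b x)^-1 * G 1 x).
  by apply: measurable_funM => //; exact: measurable_funM.
have p1 x : 0 <= rO x * (b x)^-1 * G 1 x by rewrite !mulr_ge0// ltW.
rewrite integral_peel.
(* With node [K.*2.+4] removed, only [G K.*2.+2] still involves block [K.*2.+3]; averaging it gives
   [b], which cancels the inverse. *)
- rewrite (integral_avg (c := K.*2.+3))//.
    rewrite -integral_rO; apply: eq_integral => x _; congr EFin.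
    by rewrite -/(b x); field; rewrite gt_eqF.
  apply: indM; last by apply: Gind; rewrite /far; lia.
  apply: indM; first by apply: indrO; rewrite !inE eqxx orbT.
  by apply: indV; apply: indb; rewrite !inE eqxx orbT.
- exact: measurable_funM.
- by move=> x; rewrite mulr_ge0// ltW.
- apply: indM; last by apply: Gind; rewrite /far; lia.
  apply: indM; last by apply: Gind; rewrite /far; lia.
  apply: indM; first by apply: indrO; rewrite !inE eqxx !orbT.
  by apply: indV; apply: indb; rewrite !inE eqxx !orbT.
Qed.

Let integral_T4 : (\int[mu]_x (T4 x)%:E = 1)%E.
Proof.
have maV := mV ma a0.
have V0 x : 0 <= (a x)^-1 by rewrite invr_ge0 ltW.
have m1 : measurable_fun setT (fun x => rE x * (a x)^-1 * G K.*2.+2 x).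
  by apply: measurable_funM => //; exact: measurable_funM.
have p1 x : 0 <= rE x * (a x)^-1 * G K.*2.+2 x by rewrite !mulr_ge0// ltW.
rewrite integral_peel.
- rewrite (integral_avg (c := 0))//.
    rewrite -integral_rE; apply: eq_integral => x _; congr EFin.
    by rewrite -/(a x); field; rewrite gt_eqF.
  apply: indM; last by apply: Gind; rewrite /far; lia.
  apply: indM; first by apply: indrE; rewrite !inE.
  by apply: indV; apply: inda; rewrite !inE.
- exact: measurable_funM.
- by move=> x; rewrite mulr_ge0// ltW.
- apply: indM; last by apply: Gind; rewrite /far; lia.
  apply: indM; last by apply: Gind; rewrite /far; lia.
  apply: indM; first by apply: indrE; rewrite !inE eqxx !orbT.
  by apply: indV; apply: inda; rewrite !inE eqxx !orbT.
Qed.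

Lemma prod_cycle x : \prod_(i < m) G i x =
  rO x * rE x * (G 0 x * G 1 x * G K.*2.+2 x * G K.*2.+3 x * G K.*2.+4 x).
Proof.
rewrite -(big_mkord predT (fun i => G i x)) /m 3?big_nat_recr//=.
rewrite (_ : \prod_(0 <= i < K.*2.+2) _ = G 0 x * G 1 x * (rO x * rE x)); last first.
  rewrite /rO /rE /sO /sE !big_map -{2 3}(subn0 K) -/(index_iota 0 K).
  elim: (K) => [|k IH].
    by rewrite 2?big_nat_recr//= !big_geq//; ring.
  rewrite doubleS 2?big_nat_recr//= IH.
  by rewrite ![\prod_(0 <= i < k.+1) _]big_nat_recr//=; ring.
ring.
Qed.

(** Each factor occurs in exactly two of the four functions, while [a] cancels between [T1] and
    [T4], and [b] between [T2] and [T3]. *)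
Lemma cycle_factorization : exists T : 'I_4 -> Om -> R,
  [/\ forall s, measurable_fun setT (T s), forall s x, 0 < T s x,
      forall s, (\int[mu]_x (T s x)%:E = 1)%E &
      forall x, \prod_s T s x = (\prod_(i < m) G i x) ^+ 2].
Proof.
exists (fun s => nth T1 [:: T1; T2; T3; T4] s); split.
- have mbV := mV mb b0; have maV := mV ma a0.
  by case=> -[|[|[|[|//]]]] ? /=; do ! apply: measurable_funM.
- case=> -[|[|[|[|//]]]] ? x /=; by rewrite /T1 /T2 /T3 /T4 !mulr_gt0// invr_gt0.
- by case=> -[|[|[|[|//]]]] ? /=.
- move=> x; rewrite prod_cycle !big_ord_recr big_ord0 /= /T1 /T2 /T3 /T4.
  by field; rewrite !gt_eqF.
Qed.

End CycleCore.

(** * Converse *)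

Section FamilyLaw.
Context {R : realType} {d : measure_display} {T : measurableType d}.
Variables (P : probability T R) (m : nat) (X : 'I_m -> nat -> T -> R).
Hypothesis sX : iid_std_gaussian_source P X.
Context {I : finType}.
Variable g : I -> 'I_m * nat.
Hypothesis injg : injective g.
Local Notation gauss := (normal_prob (0 : R) 1).

Definition family (w : T) : #|I|.-tuple R := tup (fun p => X (g p).1 (g p).2 w).

Lemma measurable_family : measurable_fun setT family.
Proof.
apply: (measurable_tup (F := fun p => X (g p).1 (g p).2)) => p.
by have [mX _] := sX.
Qed.

Lemma family_law B : (forall p, measurable (B p)) ->
  P (family @^-1` rect B) = (\prod_p gauss (B p))%E.
Proof.
move=> mB; have [mX [lX iX]] := sX.
(* Independence of the source is stated for sets indexed by all pairs of node and time, so [B] is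
   carried along the injection [g] and filled up with [setT]. *)
pose B' q := if [pick p | g p == q] is Some p then B p else setT.
have B'g p : B' (g p) = B p.
  rewrite /B'; case: pickP => [q /eqP/injg -> //|/(_ p)]; by rewrite eqxx.
have mB' q : measurable (B' q) by rewrite /B'; case: pickP.
have := iX [seq g p | p <- enum I] B' _ mB'.
rewrite map_inj_uniq// enum_uniq big_map big_enum/= => /(_ isT) h.
transitivity (P (\bigcap_(q in [set` [seq g p | p <- enum I]]) (X q.1 q.2 @^-1` B' q))).
  congr (P _); apply/seteqP; split => w /=.
    by move=> wB q /= /mapP[p _ ->]; rewrite /= B'g; have := wB p; rewrite co_tup.
  move=> wB p; rewrite co_tup -B'g; apply: (wB (g p)) => /=.
  by apply: map_f; rewrite mem_enum.
by rewrite h; apply: eq_bigr => p _; rewrite B'g lX.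
Qed.

(** The required law is the distribution of the source symbols themselves. *)
Lemma exists_gaussian : exists mu : probability (#|I|.-tuple R) R, gaussian mu.
Proof.
pose W : {mfun T >-> #|I|.-tuple R} :=
  HB.pack family (isMeasurableFun.Build _ _ _ _ _ measurable_family).
by exists (distribution P W) => B mB; exact: family_law.
Qed.

Lemma integral_family (mu : probability (#|I|.-tuple R) R) (f : #|I|.-tuple R -> \bar R) :
  gaussian mu -> measurable_fun setT f -> (forall x, 0 <= f x)%E ->
  (\int[P]_w f (family w) = \int[mu]_x f x)%E.
Proof.
move=> gmu mf f0; apply/esym; apply: gaussian_law => //.
- exact: measurable_family.
- exact: family_law.
Qed.

End FamilyLaw.

Lemma ln_prod {R : realType} (I : Type) (s : seq I) (f : I -> R) :
  (forall i, 0 < f i) -> ln (\prod_(i <- s) f i) = \sum_(i <- s) ln (f i).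
Proof.
move=> f0; elim: s => [|i s IH]; first by rewrite !big_nil ln1.
by rewrite !big_cons lnM ?IH// posrE// prodr_gt0.
Qed.

Lemma ordS_val k (i : nat) : (i < k)%N -> (i.+1 %% k = if i.+1 == k then 0 else i.+1)%N.
Proof.
by move=> ik; case: eqP => [->|/eqP ne]; [exact: modnn|rewrite modn_small// ltn_neqAle ne].
Qed.

Lemma ord_pred_val k (i : nat) : (i < k)%N ->
  ((i + k).-1 %% k = if i == 0 then k.-1 else i.-1)%N.
Proof.
case: i => [|i] ik /=; first by rewrite add0n modn_small// prednK.
by rewrite modnDr modn_small// ltnW.
Qed.

Lemma integral_sumE d (T : measurableType d) (R : realType)
    (nu : {measure set T -> \bar R}) (I : Type) (s : seq I) (f : I -> T -> R) :
  (forall i, measurable_fun setT (f i)) -> (forall i x, 0 <= f i x) ->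
  (\int[nu]_x (\sum_(i <- s) f i x)%:E = \sum_(i <- s) \int[nu]_x (f i x)%:E)%E.
Proof.
move=> mf f0; under eq_integral do rewrite -sumEFin.
rewrite ge0_integral_sum//; first by move=> i; exact/measurable_EFinP.
by move=> i x _; rewrite lee_fin.
Qed.

Section FiniteSwitch.
Context d d' (T : measurableType d) (U : measurableType d') (M : nat).
Variables (J : T -> 'I_M) (f : 'I_M -> T -> U).

Lemma measurable_fun_switch :
  (forall j, measurable (J @^-1` [set j])) -> (forall j, measurable_fun setT (f j)) ->
  measurable_fun setT (fun x => f (J x) x).
Proof.
move=> mJ mf _ Y mY; rewrite setTI.
rewrite (_ : _ @^-1` _ = \big[setU/set0]_(j < M) (J @^-1` [set j] `&` f j @^-1` Y)).
  apply: bigsetU_measurable => j _; apply: measurableI => //.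
  by rewrite -[X in measurable X]setTI; exact: mf.
apply/seteqP; split => x /=.
  by move=> fx; rewrite -bigcup_seq; exists (J x) => //=; rewrite mem_index_enum.
by rewrite -bigcup_seq => -[j _ /= [<-]].
Qed.

End FiniteSwitch.

Lemma converse_arith1 (R : realFieldType) (s w e l lM m n : R) :
  2 * (m * (n * (l / 2)) + (s - e) / 2) <= w - 4 + 4 * lM ->
  s + (m * n * l + 4 - 4 * lM) <= w + e.
Proof. lra. Qed.

Lemma converse_arith2 (R : realFieldType) (a l lM m n : R) :
  m * n + (a + (m * n * l + 4 - 4 * lM)) <= 4 + m * n + a -> m * n * l <= 4 * lM.
Proof. lra. Qed.

Section Converse.
Context {R : realType} {d : measure_display} {T : measurableType d}.
Variables (P : probability T R) (K : nat).
Let m := K.*2.+1.+4.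
Variable X : 'I_m -> nat -> T -> R.
Hypothesis sX : iid_std_gaussian_source P X.
Variables (n M : nat) (V : R).
Hypotheses (n0 : (0 < n)%N) (V0 : 0 < V).
Variable enc : n.-tuple (m.-tuple R) -> 'I_M.
Variable dec : 'I_m -> 'I_M -> n.-tuple (R * R) -> n.-tuple R.
Hypothesis menc : forall j : 'I_M, measurable (enc @^-1` [set j]).
Hypothesis mdec : forall (i : 'I_m) (j : 'I_M), measurable_fun setT (dec i j).
Hypothesis mseV : forall i, (mse P X enc dec i <= V%:E)%E.

Let I : finType := ('I_m * 'I_n)%type.
Let Om := #|I|.-tuple R.
Let g (p : I) : 'I_m * nat := (p.1, val p.2).

Let injg : injective g.
Proof. by move=> [i k] [i' k'] [-> /val_inj ->]. Qed.

Let src (x : Om) : n.-tuple (m.-tuple R) := [tuple [tuple co x (i, k) | i < m] | k < n].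
Let side (i : 'I_m) (x : Om) : n.-tuple (R * R) :=
  [tuple (co x (ord_pred i, k), co x (ordS i, k)) | k < n].

Let src_family w : src (family X g w) = src_block X n w.
Proof.
apply: eq_from_tnth => k; rewrite !tnth_mktuple; apply: eq_from_tnth => i.
by rewrite !tnth_mktuple co_tup.
Qed.

Let side_family i w : side i (family X g w) = side_block X i n w.
Proof. by apply: eq_from_tnth => k; rewrite !tnth_mktuple !co_tup. Qed.

Let msrc : measurable_fun setT src.
Proof.
apply/measurable_fun_tnthP => k; apply/measurable_fun_tnthP => i.
rewrite (_ : _ \o _ = co^~ (i, k)); first exact: measurable_co.
by apply/funext => x /=; rewrite !tnth_mktuple.
Qed.

Let mside i : measurable_fun setT (side i).
Proof.
apply/measurable_fun_tnthP => k.
rewrite (_ : _ \o _ = fun x => (co x (ord_pred i, k), co x (ordS i, k))).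
  by apply: measurable_fun_pair; exact: measurable_co.
by apply/funext => x /=; rewrite !tnth_mktuple.
Qed.

Let xh (j : 'I_M) (i : 'I_m) (k : 'I_n) (x : Om) : R := tnth (dec i j (side i x)) k.

Let mxh j i k : measurable_fun setT (xh j i k).
Proof.
apply: (measurableT_comp (measurable_tnth k)).
exact: (measurableT_comp (mdec i j) (mside i)).
Qed.

Let F (j : 'I_M) (i : 'I_m) (x : Om) : R := \prod_(k < n) kap V (xh j i k x) (co x (i, k)).
(** Padding with 1 outside the cycle gives the family indexed by natural numbers that the cycle
    inequality expects. *)
Let G (j : 'I_M) (i : nat) (x : Om) : R := if insub i is Some o then F j o x else 1.
Let blk (p : I) : nat := val p.1.

Let F_gt0 j i x : 0 < F j i x.
Proof. by apply: prodr_gt0 => k _; exact: kap_gt0. Qed.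

Let mF j i : measurable_fun setT (F j i).
Proof.
apply: measurable_prod => k _; apply: measurable_kap => //; exact: measurable_co.
Qed.

Let ln_F j i x : ln (F j i x) = n%:R * (ln V^-1 / 2) +
  \sum_(k < n) (co x (i, k) ^+ 2 / 2 - (co x (i, k) - xh j i k x) ^+ 2 / (V *+ 2)).
Proof.
rewrite ln_prod; last by move=> k; exact: kap_gt0.
rewrite (_ : n%:R * _ = \sum_(k < n) (ln V^-1 / 2)); last first.
  by rewrite sumr_const card_ord mulr_natl.
rewrite -big_split/=.
by apply: eq_bigr => k _; rewrite ln_kap//; ring.
Qed.

Let side_mixb (i : 'I_m) c x y : (c != (i.+1 %% m)%N) -> (c != ((i + m).-1 %% m)%N) ->
  side i (mixb blk c x y) = side i x.
Proof.
move=> c1 c2; apply: eq_from_tnth => k; rewrite !tnth_mktuple !co_mix /blk /=.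
by rewrite (eq_sym _ c) (negbTE c2) (eq_sym _ c) (negbTE c1).
Qed.

Let nbr_neq (i : 'I_m) : (i != (i.+1 %% m)%N :> nat) /\ (i != ((i + m).-1 %% m)%N :> nat).
Proof.
have im := ltn_ord i.
by rewrite ordS_val// ord_pred_val//; split; case: ifP; rewrite /m; lia.
Qed.

Let nbr_far (i : 'I_m) c : (c < m)%N ->
  [&& val i != c, i.+1 != c, c.+1 != i,
  ~~ ((val i == 0)%N && (c == K.*2.+4)) & ~~ ((c == 0)%N && (val i == K.*2.+4))] ->
  (c != (i.+1 %% m)%N) /\ (c != ((i + m).-1 %% m)%N).
Proof.
have im := ltn_ord i; rewrite ordS_val// ord_pred_val// => cm /and5P[h1 h2 h3 h4 h5].
by split; case: ifP; move: h1 h2 h3 h4 h5 im cm; rewrite /m /=; lia.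
Qed.

Variable mu : probability Om R.
Hypothesis gmu : gaussian mu.

(** Resampling node [i] leaves its side information fixed, so the centres are constants and the
    integral splits into one kernel integral per time. *)
Let F1 j i x : (\int[mu]_y (F j i (mixb blk i x y))%:E = 1)%E.
Proof.
have [n1 n2] := nbr_neq i.
pose f (p : I) (t : R) : \bar R := if p.1 == i then (kap V (xh j i p.2 x) t)%:E else 1%E.
transitivity (\int[mu]_y \prod_p f p (co y p))%E.
  apply: eq_integral => y _; rewrite /F.
  under eq_bigr => k _ do rewrite /xh side_mixb// co_mix /blk /= eqxx.
  have -> : (\prod_p f p (co y p) =
      \prod_(i' < m) \prod_(k < n) f (i', k) (co y (i', k)))%E.
    by rewrite pair_bigA; apply: eq_bigr => -[].
  rewrite (bigD1 i)//=.
  rewrite [X in (_ * X)%E]big1 ?mule1; last first.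
    by move=> i' /negbTE i'i; rewrite big1// => k _; rewrite /f /= i'i.
  by rewrite -prodEFin; apply: eq_bigr => k _; rewrite /f /= eqxx.
rewrite (integral_prod_co gmu (f := f)); last 2 first.
- move=> p; rewrite /f; case: (p.1 == i) => //; apply/measurable_EFinP.
  exact: measurable_kap.
- by move=> p t; rewrite /f; case: ifP => // _; rewrite lee_fin ltW// kap_gt0.
rewrite big1// => p _; rewrite /f; case: (p.1 == i); first exact: integral_kap.
by rewrite integral_cst//= mul1e; exact: (@probability_setT _ _ _ (normal_prob (0 : R) 1)).
Qed.

(** The symbols of node [i] itself are frozen here, so [kap_bound] gives a bound constant in [y],
    however the decoder reacts to its neighbours. *)
Let Ffin j i c x : c != val i -> (\int[mu]_y (F j i (mixb blk c x y))%:E < +oo)%E.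
Proof.
move=> ci.
pose C := \prod_(k < n) ((Num.sqrt V)^-1 * expR (co x (i, k) ^+ 2 / 2)).
apply: (@le_lt_trans _ _ (\int[mu]_y C%:E)%E).
  apply: ge0_le_integral => //.
  - by move=> y _; rewrite lee_fin ltW.
  - apply/measurable_EFinP; apply: measurableT_comp => //; exact: measurable_mix2.
  - move=> y _; rewrite lee_fin; apply: ler_prod => k _.
    rewrite ltW ?kap_gt0//= co_mix /blk /= (eq_sym _ c) (negbTE ci).
    exact: kap_bound.
rewrite integral_cst//= (_ : mu _ = 1%E) ?mule1 ?ltry//; exact: probability_setT.
Qed.

Let GE j (i : 'I_m) : G j i = F j i.
Proof. by apply/funext => x; rewrite /G valK. Qed.

Let fact j : exists Tj : 'I_4 -> Om -> R,
  [/\ forall s, measurable_fun setT (Tj s), forall s x, 0 < Tj s x,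
      forall s, (\int[mu]_x (Tj s x)%:E = 1)%E &
      forall x, \prod_s Tj s x = (\prod_(i < m) F j i x) ^+ 2].
Proof.
have [Tj [h1 h2 h3 h4]] : exists Tj : 'I_4 -> Om -> R,
  [/\ forall s, measurable_fun setT (Tj s), forall s x, 0 < Tj s x,
      forall s, (\int[mu]_x (Tj s x)%:E = 1)%E &
      forall x, \prod_s Tj s x = (\prod_(i < m) G j i x) ^+ 2].
  apply: (cycle_factorization gmu (blk := blk)).
  - by move=> i; rewrite /G; case: insubP.
  - by move=> i x; rewrite /G; case: insubP.
  - move=> i x; rewrite /G; case: insubP => [q _ oi|_]; first by rewrite -oi; exact: F1.
    by rewrite integral_cst//= mul1e; exact: probability_setT.
  - move=> i c im cm fic x y.
    have [c1 c2] := @nbr_far (Ordinal im) c cm fic.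
    rewrite -[i]/(val (Ordinal im)) !GE; apply: eq_bigr => k _.
    rewrite /xh side_mixb// co_mix /blk /= ifN//.
    by case/and5P: fic.
  - move=> i c x ci; rewrite /G; case: insubP => [q _ oi|_]; last first.
      by rewrite integral_cst//= mul1e (_ : mu _ = 1%E) ?ltry//; exact: probability_setT.
    by apply: Ffin; rewrite oi.
exists Tj; split => // x; rewrite h4; congr (_ ^+ 2).
by apply: eq_bigr => i _; rewrite GE.
Qed.


Let J (x : Om) : 'I_M := enc (src x).

Let mJ j : measurable (J @^-1` [set j]).
Proof.
rewrite -[X in measurable X]setTI; exact: (msrc measurableT (menc j)).
Qed.

Let err (i : 'I_m) (k : 'I_n) (x : Om) : R := (co x (i, k) - xh (J x) i k x) ^+ 2.

Let merr i k : measurable_fun setT (err i k).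
Proof.
apply: measurable_funX; apply: measurable_funB; first exact: measurable_co.
exact: (measurable_fun_switch mJ (fun j => mxh j i k)).
Qed.

Let integral_err i : (\sum_(k < n) \int[mu]_x (err i k x)%:E <= (n%:R * V)%:E)%E.
Proof.
have := mseV i; rewrite /mse lee_pdivrMl ?ltr0n// -EFinM.
apply: le_trans; rewrite le_eqVlt; apply/orP; left; apply/eqP.
apply: eq_bigr => k _.
rewrite -(integral_family sX injg gmu).
- by apply: eq_integral => w _; rewrite /err /xh /J src_family side_family co_tup.
- exact/measurable_EFinP.
- by move=> x; rewrite lee_fin sqr_ge0.
Qed.

Lemma converse_bound : m%:R * n%:R * ln V^-1 <= 4 * ln M%:R.
Proof.
have [Tj hT] := choice fact.
have Mgt0 : (0 < M)%N.
  by have x : Om := tup (fun=> 0); case: (J x) => j jM; exact: leq_ltn_trans jM.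
have M0 : 0 < M%:R :> R by rewrite ltr0n.
pose S (x : Om) : R := \sum_(i < m) \sum_(k < n) co x (i, k) ^+ 2.
pose E (x : Om) : R := \sum_(i < m) \sum_(k < n) err i k x.
pose W (x : Om) : R := \sum_(s < 4) \sum_(j < M) Tj j s x / M%:R.
pose c : R := m%:R * n%:R * ln V^-1 + 4 - 4 * ln M%:R.
have T0 j s x : 0 < Tj j s x by have [_ + _ _] := hT j; exact.
have mT j s : measurable_fun setT (Tj j s) by have [+ _ _ _] := hT j; exact.
have key x : S x + c <= W x + V^-1 * E x.
  pose j := J x.
  have h2 : 2 * \sum_(i < m) ln (F j i x) = \sum_(s < 4) ln (Tj j s x).
    rewrite -!ln_prod//; have [_ _ _ ->] := hT j.
    by rewrite lnXn ?prodr_gt0// mulr_natl.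
  (* The index [j] depends on [x]; adding the nonnegative terms of all other messages gives a
     function of [x] whose integral is exactly 1. *)
  have lnT (s : 'I_4) : ln (Tj j s x) <= (\sum_(j < M) Tj j s x / M%:R) - 1 + ln M%:R.
    have t0 : 0 < Tj j s x / M%:R by rewrite divr_gt0.
    rewrite -[X in ln X <= _](divfK (lt0r_neq0 M0)) lnM ?posrE// lerD2r.
    apply: (@le_trans _ _ (Tj j s x / M%:R - 1)).
      by rewrite lerBrDl -[leRHS]lnK ?posrE// expR_ge1Dx.
    rewrite lerD2r (bigD1 j)//= lerDl; apply: sumr_ge0 => j' _.
    by rewrite ltW// divr_gt0.
  have : 2 * \sum_(i < m) ln (F j i x) <= W x - 4 + 4 * ln M%:R.
    rewrite h2; apply: le_trans (ler_sum _ (fun s _ => lnT s)) _.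
    rewrite /W big_split big_split/= !sumr_const !card_ord le_eqVlt; apply/orP; left.
    by apply/eqP; ring.
  under eq_bigr do rewrite ln_F.
  rewrite big_split/= sumr_const card_ord.
  have -> : \sum_(i < m) \sum_(k < n) (co x (i, k) ^+ 2 / 2 -
      (co x (i, k) - xh j i k x) ^+ 2 / (V *+ 2)) = (S x - V^-1 * E x) / 2.
    rewrite /S /E mulr_sumr -sumrB mulr_suml; apply: eq_bigr => i _.
    rewrite mulr_sumr -sumrB mulr_suml; apply: eq_bigr => k _.
    by rewrite /err -/j; field; rewrite gt_eqF.
  rewrite /c -[_ *+ m]mulr_natl.
  exact: converse_arith1.
have Tint s j : (\int[mu]_x (Tj j s x / M%:R)%:E = (M%:R^-1)%:E)%E.
  under eq_integral do rewrite EFinM.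
  rewrite ge0_integralZr//.
  - by have [_ _ -> _] := hT j; rewrite mul1e.
  - exact/measurable_EFinP.
  - by move=> x _; rewrite lee_fin ltW.
have mTM s j : measurable_fun setT (fun x => Tj j s x / M%:R) by exact: measurable_funM.
have T0M s j x : 0 <= Tj j s x / M%:R by rewrite divr_ge0 ?ltW.
have msq i k : measurable_fun setT (fun x : Om => co x (i, k) ^+ 2).
  by apply: measurable_funX; exact: measurable_co.
have err0 i k x : 0 <= err i k x by exact: sqr_ge0.
have Wint : (\int[mu]_x (W x)%:E = 4%:E)%E.
  rewrite integral_sumE; last 2 first.
  - by move=> s; exact: measurable_sum.
  - by move=> s x; exact: sumr_ge0.
  transitivity (\sum_(s < 4) (1 : R)%:E)%E; last by rewrite sumEFin sumr_const card_ord.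
  apply: eq_bigr => s _; rewrite integral_sumE//.
  under eq_bigr do rewrite Tint.
  by rewrite sumEFin sumr_const card_ord -[_ *+ M]mulr_natl mulfV ?gt_eqF.
have Sint : (\int[mu]_x (S x)%:E = (m%:R * n%:R)%:E)%E.
  rewrite integral_sumE; last 2 first.
  - by move=> i; exact: measurable_sum.
  - by move=> i x; apply: sumr_ge0 => k _; exact: sqr_ge0.
  transitivity (\sum_(i < m) (n%:R : R)%:E)%E; last first.
    by rewrite sumEFin sumr_const card_ord mulr_natl.
  apply: eq_bigr => i _; rewrite integral_sumE//; last by move=> k x; exact: sqr_ge0.
  transitivity (\sum_(k < n) (1 : R)%:E)%E; last by rewrite sumEFin sumr_const card_ord.
  apply: eq_bigr => k _; rewrite -integral_sqr.
  apply: (integral_co gmu (i, k) (f := fun t => (t ^+ 2)%:E)).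
    by apply/measurable_EFinP; exact: measurable_funX.
  by move=> t; rewrite lee_fin sqr_ge0.
have Eint : (\int[mu]_x (E x)%:E <= (m%:R * (n%:R * V))%:E)%E.
  rewrite integral_sumE; last 2 first.
  - by move=> i; exact: measurable_sum.
  - by move=> i x; exact: sumr_ge0.
  apply: (@le_trans _ _ (\sum_(i < m) (n%:R * V)%:E)%E); last first.
    by rewrite sumEFin sumr_const card_ord -[_ *+ m]mulr_natl.
  by apply: lee_sum => i _; rewrite integral_sumE.
have mS : measurable_fun setT (fun x => (S x)%:E).
  by apply/measurable_EFinP; apply: measurable_sum => i; exact: measurable_sum.
have mE : measurable_fun setT (fun x => (E x)%:E).
  by apply/measurable_EFinP; apply: measurable_sum => i; exact: measurable_sum.
have mW : measurable_fun setT (fun x => (W x)%:E).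
  by apply/measurable_EFinP; apply: measurable_sum => i; exact: measurable_sum.
have S0 x : (0 <= (S x)%:E)%E.
  by rewrite lee_fin; do 2 (apply: sumr_ge0 => ? _); exact: sqr_ge0.
have E0 x : (0 <= (E x)%:E)%E.
  by rewrite lee_fin; do 2 (apply: sumr_ge0 => ? _).
have W0 x : (0 <= (W x)%:E)%E.
  by rewrite lee_fin; do 2 (apply: sumr_ge0 => ? _).
have V10 : (0 <= V^-1%:E)%E by rewrite lee_fin invr_ge0 ltW.
(* The constant [c] may be negative; adding its absolute value to both sides of [key] keeps all
   integrands nonnegative. *)
have c0 : (0 <= (`|c| + c)%:E)%E.
  by rewrite lee_fin addrC -lerBlDr sub0r lerNnormlW.
have VE0 x : (0 <= V^-1%:E * (E x)%:E)%E by rewrite mule_ge0.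
have mVE : measurable_fun setT (fun x => V^-1%:E * (E x)%:E)%E.
  exact: emeasurable_funM.
have cst_int (a : R) : (\int[mu]_x a%:E = a%:E)%E.
  by rewrite integral_cst//= (_ : mu _ = 1%E) ?mule1//; exact: probability_setT.
have : (\int[mu]_x ((S x)%:E + (`|c| + c)%:E) <=
        \int[mu]_x ((W x)%:E + V^-1%:E * (E x)%:E + `|c|%:E))%E.
  apply: ge0_le_integral => //.
  - by move=> x _; rewrite adde_ge0.
  - exact: emeasurable_funD.
  - by apply: emeasurable_funD => //; exact: emeasurable_funD.
  - move=> x _; rewrite -EFinM -!EFinD lee_fin addrCA addrC lerD2r; exact: key.
rewrite ge0_integralD// ge0_integralD//; last 2 first.
- by move=> x _; rewrite adde_ge0.
- exact: emeasurable_funD.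
rewrite ge0_integralD// ge0_integralZl// !cst_int Sint Wint.
(* Divided by V, the total distortion is at most m n, which is the integral of [S]: the two cancel
   and only the logarithms remain. *)
have : (V^-1%:E * \int[mu]_x (E x)%:E <= (m%:R * n%:R)%:E)%E.
  rewrite lee_pdivrMl// -EFinM (_ : V * _ = m%:R * (n%:R * V))//; ring.
move=> /(leeD2l 4%:E)/(leeD2r `|c|%:E) h1 /le_trans/(_ h1).
rewrite -!EFinD lee_fin /c; exact: converse_arith2.
Qed.

End Converse.

(** * Random coding *)

Lemma measurable_natrb d (T : measurableType d) (R : realType) (b : T -> bool) :
  measurable_fun setT b -> measurable_fun setT (fun x => (b x)%:R : R).
Proof.
move=> mb; rewrite (_ : (fun _ => _) = fun x => if b x then 1 else 0 : R).
  exact: measurable_fun_ifT.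
by apply/funext => x; case: (b x).
Qed.

(** The probabilistic method: if f exceeded its mean everywhere, the positive function f minus its
    mean would have integral 0. *)
Lemma exists_le_integral d (T : measurableType d) (R : realType) (P : probability T R)
    (f : T -> \bar R) :
  measurable_fun setT f -> (forall x, 0 <= f x)%E -> exists x, (f x <= \int[P]_y f y)%E.
Proof.
move=> mf f0; apply/not_existsP => h.
have {}h x : (\int[P]_y f y < f x)%E by rewrite ltNge; apply/negP.
set a := (\int[P]_y f y)%E in h.
have a0 : (0 <= a)%E by exact: integral_ge0.
have [x _] : exists x : T, setT x.
  apply/set0P/eqP => T0; have /eqP := probability_setT P.
  by rewrite T0 measure0 eq_sym onee_eq0.
have afin : a \is a fin_num by rewrite ge0_fin_numE// (lt_le_trans (h x))// leey.
have g0 y : (0 < f y - a)%E by rewrite sube_gt0.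
have mg : measurable_fun setT (fun y => f y - a)%E by exact: emeasurable_funB.
have := integral_gt0 P mg g0; rewrite lt_neqAle => /andP[/eqP + _]; apply.
have : (a = \int[P]_y (f y - a) + a)%E.
  transitivity (\int[P]_y ((f y - a) + a))%E.
    by apply: eq_integral => y _; rewrite subeK.
  rewrite ge0_integralD//; last by move=> y _; exact: ltW.
  by rewrite integral_cst//= (_ : P _ = 1%E) ?mule1//; exact: probability_setT.
by move/(congr1 (fun t => t - a)%E); rewrite subee// addeK.
Qed.

(* Random coding, derandomized one codeword at a time: some codeword is at least
   as good as a random one for the current weight, which is then reduced to the
   points that this codeword misses. *)
Section Codewords.
Context d (T : measurableType d) (R : realType) (P : probability T R).
Variable miss : T -> T -> bool.
Hypothesis mmiss : measurable_fun setT (fun z : T * T => miss z.1 z.2).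

Definition pmiss (x : T) : R := fine (\int[P]_z ((miss x z)%:R)%:E).

Let mmissE : measurable_fun setT (fun z : T * T => ((miss z.1 z.2)%:R : R)%:E).
Proof. by apply/measurable_EFinP; exact: measurable_natrb. Qed.

Lemma measurable_miss1 z : measurable_fun setT (fun x => (miss x z)%:R : R).
Proof.
apply: measurable_natrb.
exact: (measurableT_comp mmiss (measurable_pair2 z)).
Qed.

Lemma measurable_miss2 x : measurable_fun setT (fun z => (miss x z)%:R : R).
Proof.
apply: measurable_natrb.
exact: (measurableT_comp mmiss (measurable_pair1 x)).
Qed.

Lemma pmissE x : ((pmiss x)%:E = \int[P]_z ((miss x z)%:R)%:E)%E.
Proof.
have le1 : (\int[P]_z ((miss x z)%:R : R)%:E <= \int[P]_z (1 : R)%:E)%E.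
  apply: ge0_le_integral => //.
  - by apply/measurable_EFinP; exact: measurable_miss2.
  - by move=> z _; rewrite lee_fin; case: miss.
rewrite fineK// ge0_fin_numE ?integral_ge0// (le_lt_trans le1)//.
by rewrite integral_cst//= (_ : P _ = 1%E) ?mule1 ?ltry//; exact: probability_setT.
Qed.

Lemma pmiss_ge0 x : 0 <= pmiss x.
Proof. by rewrite -lee_fin pmissE integral_ge0. Qed.

Lemma measurable_pmiss : measurable_fun setT pmiss.
Proof.
apply: (measurableT_comp (fine_measurable measurableT)) => //.
exact: (measurable_fun_fubini_tonelli_F (m2 := P)
  (fun z : T * T => ((miss z.1 z.2)%:R : R)%:E)).
Qed.

Lemma exists_codewords (N : nat) (w : T -> R) :
  measurable_fun setT w -> (forall x, 0 <= w x) ->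
  exists2 s : seq T, size s = N &
    (\int[P]_x (w x * \prod_(z <- s) (miss x z)%:R)%:E <=
     \int[P]_x (w x * pmiss x ^+ N)%:E)%E.
Proof.
elim: N w => [|N IH] w mw w0.
  by exists [::] => //; under eq_integral do rewrite big_nil.
(* The factor [pmiss x ^+ N] stands for the N codewords that are still random while [z] is being
   chosen. *)
pose w' x := w x * pmiss x ^+ N.
have mw' : measurable_fun setT w'.
  by apply: measurable_funM => //; apply: measurable_funX; exact: measurable_pmiss.
have w'0 x : 0 <= w' x by rewrite mulr_ge0// exprn_ge0// pmiss_ge0.
pose h (z : T * T) : \bar R := (w' z.1 * (miss z.1 z.2)%:R)%:E.
have mh : measurable_fun setT h.
  apply/measurable_EFinP; apply: measurable_funM; last exact: measurable_natrb.
  exact: (measurableT_comp mw' measurable_fst).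
have h0 z : (0 <= h z)%E by rewrite lee_fin mulr_ge0.
have mG := measurable_fun_fubini_tonelli_G (m1 := P) h mh h0.
have [z|z hz] := exists_le_integral P mG; first by apply: integral_ge0 => x _; exact: h0.
have [|x|s ss hs] := IH (fun x => w x * (miss x z)%:R).
- by apply: measurable_funM => //; exact: measurable_miss1.
- by rewrite mulr_ge0.
exists (z :: s); first by rewrite /= ss.
under eq_integral do rewrite big_cons mulrA.
apply: (le_trans hs).
under eq_integral do rewrite mulrAC.
apply: (le_trans hz).
rewrite -(fubini_tonelli (m1 := P) (m2 := P) h)// le_eqVlt; apply/orP; left; apply/eqP.
apply: eq_integral => x _; rewrite /h /=.
under eq_integral do rewrite EFinM.
rewrite ge0_integralZl//.
- by rewrite -pmissE -EFinM /w' exprSr mulrA.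
- by apply/measurable_EFinP; exact: measurable_miss2.
- by rewrite lee_fin.
Qed.

End Codewords.

(** A form of the covering-lemma inequality (1 - x y)^N <= 1 - x + exp(- N y), with the cruder error
    1/a, for which exp(- t) <= 1 / (1 + t) suffices. *)
Lemma expRN_le (R : realType) (a q : R) : 0 < a -> 0 <= q <= 1 ->
  expR (- (a * q)) <= 1 - q + a^-1.
Proof.
move=> a0 /andP[q0 q1].
have p0 : 0 < 1 + a * q by rewrite ltr_pwDl// mulr_ge0// ltW.
apply: (@le_trans _ _ (1 + a * q)^-1).
  by rewrite expRN lef_pV2 ?posrE ?expR_gt0// expR_ge1Dx.
rewrite -div1r ler_pdivrMr//.
rewrite (_ : _ * _ = 1 + a^-1 + a * (q * (1 - q))); last by field; rewrite gt_eqF.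
have : 0 <= a * (q * (1 - q)) by rewrite !mulr_ge0 ?subr_ge0// ltW.
have : 0 <= a^-1 by rewrite invr_ge0 ltW.
lra.
Qed.

Section ChernoffRate.
Context {R : realType}.

(** The optimal Chernoff factor per coordinate for the event that a sum of squares of l standard
    Gaussians passes l u, in either tail. *)
Definition chrate (u : R) : R := Num.sqrt u * expR (- ((u - 1) / 2)).

Lemma chrate_ge0 u : 0 <= chrate u.
Proof. by rewrite mulr_ge0 ?sqrtr_ge0// expR_ge0. Qed.

Lemma chrate_lt1 u : 0 < u -> u != 1 -> chrate u < 1.
Proof.
move=> u0 u1; rewrite /chrate -[ltRHS]expR0 -[X in X * _]lnK ?posrE ?sqrtr_gt0// -expRD ltr_expR.
rewrite -powR12_sqrt ?ltW// ln_powR.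
suff : ln u < u - 1 by lra.
rewrite ltrBrDl -[ltRHS]lnK ?posrE//; apply: expR_gt1Dx.
by rewrite ln_eq0.
Qed.

End ChernoffRate.

(** * Covering a Gaussian vector *)

Section DoubleIntegral.
Context d (T : measurableType d) (R : realType) (P : probability T R).
Implicit Types f g : T -> T -> R.

Definition dint f : \bar R := (\int[P]_x \int[P]_z (f x z)%:E)%E.

Definition jmeas f := measurable_fun setT (fun p : T * T => f p.1 p.2).

Lemma jmeas2 f x : jmeas f -> measurable_fun setT (f x).
Proof. by move=> mf; exact: (measurableT_comp mf (measurable_pair1 x)). Qed.

Lemma dintE f : jmeas f -> (forall x z, 0 <= f x z) ->
  dint f = (\int[(P \x P)%E]_p (f p.1 p.2)%:E)%E.
Proof.
move=> mf f0; rewrite (fubini_tonelli1 (fun p : T * T => (f p.1 p.2)%:E))//.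
  exact/measurable_EFinP.
by move=> p; rewrite lee_fin.
Qed.

Lemma dint_swap f : jmeas f -> (forall x z, 0 <= f x z) ->
  dint f = (\int[P]_z \int[P]_x (f x z)%:E)%E.
Proof.
move=> mf f0; rewrite /dint (fubini_tonelli (fun p : T * T => (f p.1 p.2)%:E))//.
  exact/measurable_EFinP.
by move=> p; rewrite lee_fin.
Qed.

Lemma le_dint f g : jmeas f -> jmeas g -> (forall x z, 0 <= f x z <= g x z) ->
  (dint f <= dint g)%E.
Proof.
move=> mf mg fg.
have f0 x z : 0 <= f x z by have /andP[] := fg x z.
have fg' x z : f x z <= g x z by have /andP[] := fg x z.
rewrite !dintE//; last by move=> x z; exact: le_trans (f0 x z) _.
apply: ge0_le_integral => //; do ?[exact/measurable_EFinP];
by move=> p _; rewrite lee_fin.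
Qed.

Lemma dintD f g : jmeas f -> jmeas g -> (forall x z, 0 <= f x z) ->
  (forall x z, 0 <= g x z) ->
  dint (fun x z => f x z + g x z) = (dint f + dint g)%E.
Proof.
move=> mf mg f0 g0; rewrite !dintE//; last 2 first.
- exact: measurable_funD.
- by move=> x z; rewrite addr_ge0.
under eq_integral do rewrite EFinD.
rewrite ge0_integralD//; do ?[exact/measurable_EFinP];
by move=> p _; rewrite lee_fin.
Qed.

Lemma dintZl f a : jmeas f -> (forall x z, 0 <= f x z) -> 0 <= a ->
  dint (fun x z => a * f x z) = (a%:E * dint f)%E.
Proof.
move=> mf f0 a0; rewrite !dintE//; last 2 first.
- exact: measurable_funM.
- by move=> x z; rewrite mulr_ge0.
under eq_integral do rewrite EFinM.
rewrite ge0_integralZl//; do ?[exact/measurable_EFinP].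
by move=> p _; rewrite lee_fin.
Qed.

End DoubleIntegral.

(** A Chernoff bound for the value [t] itself rather than for the event. The prefactor is linear in
    [l], so it disappears from the distortion per symbol. *)
Lemma le_chernoff (R : realType) (l : nat) (lam u t : R) : (0 < l)%N -> 0 < lam ->
  l%:R * u < t ->
  t <= l%:R / lam * expR (lam * u) * expR (lam * (t - l%:R * u)).
Proof.
move=> l0 lam0 ut.
have l1 : 1 <= l%:R :> R by rewrite ler1n.
have lR : 0 < l%:R :> R by rewrite ltr0n.
apply: (@le_trans _ _ (l%:R / lam * expR (lam * t / l%:R))).
  rewrite mulrAC ler_pdivlMr// -ler_pdivrMl// mulrC [t * lam]mulrC.
  by apply: le_trans (expR_ge1Dx _); rewrite lerDr.
rewrite -[leRHS]mulrA -expRD ler_pM2l ?divr_gt0// ler_expR.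
rewrite (_ : lam * t / l%:R = lam * u + lam * (t - l%:R * u) / l%:R); last first.
  by field; rewrite gt_eqF.
by rewrite lerD2l ler_pdivrMr// ler_peMr// mulr_ge0 ?ltW// subr_gt0.
Qed.

Lemma miss_arith (R : realFieldType) (C p q : R) : 0 < C ->
  1 + C * p <= C + q -> p <= 1 - C^-1 * (1 - q).
Proof.
move=> C0 h; rewrite -(ler_pM2l C0) mulrBr mulr1 mulrA divff ?gt_eqF// mul1r; lra.
Qed.

Section Quantizer.
Context {R : realType} (l : nat).
Local Notation Om := (#|'I_l|.-tuple R).
Local Notation gauss := (normal_prob (0 : R) 1).
Variable mu : probability Om R.
Hypothesis gmu : gaussian mu.
Hypothesis l0 : (0 < l)%N.
Variables D de : R.
Hypotheses (D0 : 0 < D) (D1 : D <= 1) (de0 : 0 < de) (de1 : de < 1).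

Let al := Num.sqrt (1 - D).
Let alE : al ^+ 2 = 1 - D. Proof. by rewrite sqr_sqrtr// subr_ge0. Qed.

Definition nrm (x : Om) : R := \sum_(k < l) co x k ^+ 2.
Definition dst (x z : Om) : R := \sum_(k < l) (co x k - al * co z k) ^+ 2.
(** Density, with respect to two independent copies of [mu], of the test channel x = al z + noise of
    variance D; since al^2 = 1 - D, both marginals are standard. *)
Let rho (x z : Om) : R := \prod_(k < l) kap D (al * co z k) (co x k).

Let u := 1 + de.
Let u' := 1 - de.
Let lam (t : R) := (1 - t^-1) / 2.

(** The upper bound on [dst] controls the distortion. The norm bound and the lower bound on [dst]
    control the rate, by keeping [rho] below exp of [c] (see [rho_good]). *)
Definition good (x z : Om) : bool :=
  [&& nrm x <= l%:R * u, l%:R * (D * u') <= dst x z & dst x z <= l%:R * (D * u)].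
Definition miss (x z : Om) : bool := ~~ good x z.

Let u0 : 0 < u. Proof. by rewrite /u addr_gt0. Qed.
Let u'0 : 0 < u'. Proof. by rewrite /u' subr_gt0. Qed.
Let lam_u : 0 < lam u.
Proof. by rewrite /lam divr_gt0// subr_gt0 invf_lt1// /u ltrDl. Qed.
Let lam_u' : lam u' < 0.
Proof. by rewrite /lam pmulr_llt0 ?invr_gt0// subr_lt0 invf_gt1// /u' ltrBlDr ltrDl. Qed.
Let lR0 : 0 < l%:R :> R. Proof. by rewrite ltr0n. Qed.

Lemma measurable_nrm : measurable_fun setT nrm.
Proof.
by apply: measurable_sum => k; apply: measurable_funX; exact: measurable_co.
Qed.

Lemma measurable_dst : jmeas dst.
Proof.
apply: measurable_sum => k; apply: measurable_funX; apply: measurable_funB.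
  exact: (measurableT_comp (measurable_co k) measurable_fst).
apply: measurable_funM => //.
exact: (measurableT_comp (measurable_co k) measurable_snd).
Qed.

Let measurable_nrm1 : jmeas (fun x z => nrm x).
Proof. exact: (measurableT_comp measurable_nrm measurable_fst). Qed.

Lemma measurable_miss : measurable_fun setT (fun p : Om * Om => miss p.1 p.2).
Proof.
apply: measurable_neg; apply: measurable_and; first exact: measurable_fun_ler.
by apply: measurable_and; apply: measurable_fun_ler => //; exact: measurable_dst.
Qed.

Let measurable_rho : jmeas rho.
Proof.
apply: measurable_prod => k _; apply: measurable_kap.
  apply: measurable_funM => //.
  exact: (measurableT_comp (measurable_co k) measurable_snd).
exact: (measurableT_comp (measurable_co k) measurable_fst).
Qed.

Let rho_gt0 x z : 0 < rho x z.
Proof. by apply: prodr_gt0 => k _; exact: kap_gt0. Qed.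

Lemma nrm_ge0 x : 0 <= nrm x.
Proof. by apply: sumr_ge0 => k _; exact: sqr_ge0. Qed.

Let integral_prod1 (f : 'I_l -> R -> R) v :
  (forall k, measurable_fun [set: R] (f k)) -> (forall k t, 0 <= f k t) ->
  (forall k, \int[gauss]_t (f k t)%:E = v%:E)%E ->
  (\int[mu]_x (\prod_(k < l) f k (co x k))%:E = (v ^+ l)%:E)%E.
Proof.
move=> mf f0 fv; under eq_integral do rewrite -prodEFin.
rewrite (integral_prod_co gmu (f := fun k t => (f k t)%:E)).
- under eq_bigr do rewrite fv.
  by rewrite prodEFin prodr_const card_ord.
- by move=> k; exact/measurable_EFinP.
- by move=> k t; rewrite lee_fin.
Qed.

Lemma integral_nrm : (\int[mu]_x (nrm x)%:E = l%:R%:E)%E.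
Proof.
rewrite integral_sumE; last 2 first.
- by move=> k; apply: measurable_funX; exact: measurable_co.
- by move=> k x; exact: sqr_ge0.
transitivity (\sum_(k < l) (1 : R)%:E)%E; last by rewrite sumEFin sumr_const card_ord.
apply: eq_bigr => k _; rewrite -integral_sqr.
apply: (integral_co gmu k (f := fun t => (t ^+ 2)%:E)).
  by apply/measurable_EFinP; exact: measurable_funX.
by move=> t; rewrite lee_fin sqr_ge0.
Qed.

Let integral_rho x : (\int[mu]_z (rho x z)%:E = 1)%E.
Proof.
have rhoE z : rho x z = \prod_(k < l) kap D (al * co x k) (co z k).
  by apply: eq_bigr => k _; exact: kap_sym.
under eq_integral do rewrite rhoE.
rewrite (integral_prod1 (f := fun k => kap D (al * co x k)) (v := 1)) ?expr1n//.
- by move=> k; exact: measurable_kap.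
- by move=> k t; rewrite ltW// kap_gt0.
- by move=> k; exact: integral_kap.
Qed.

Let chernoff_exp t : 0 < t ->
  expR (- (lam t * (l%:R * t))) * Num.sqrt t ^+ l = chrate t ^+ l.
Proof.
move=> t0; rewrite /chrate exprMn -expRM_natl mulrC; congr (_ * expR _).
by rewrite /lam; field; rewrite gt_eqF.
Qed.

Let integral_nrm_exp t : 0 < t ->
  (\int[mu]_x (expR (lam t * (nrm x - l%:R * t)))%:E = (chrate t ^+ l)%:E)%E.
Proof.
move=> t0; rewrite -chernoff_exp// EFinM.
have mq : measurable_fun [set: R] (fun s : R => expR (lam t * s ^+ 2)).
  by apply: measurableT_comp => //; apply: measurable_funM.
rewrite -(integral_prod1 (f := fun k s => expR (lam t * s ^+ 2))); last 3 first.
- by [].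
- by move=> k s; exact: expR_ge0.
- by move=> k; exact: integral_expR_sqr.
rewrite -ge0_integralZl//; last 2 first.
- apply/measurable_EFinP; apply: measurable_prod => k _.
  exact: (measurableT_comp mq (measurable_co k)).
- by move=> x _; rewrite lee_fin; apply: prodr_ge0 => k _; exact: expR_ge0.
apply: eq_integral => x _; rewrite -EFinM -expR_sum -expRD; congr (expR _)%:E.
by rewrite mulrBr addrC mulr_sumr.
Qed.

(** Given z, the coordinates of x - al z are independent of variance D under the test channel, so
    dst / D behaves like a sum of l squared standard Gaussians. *)
Let integral_dst_exp t z : 0 < t ->
  (\int[mu]_x (rho x z * expR (lam t * (dst x z / D - l%:R * t)))%:E =
   (chrate t ^+ l)%:E)%E.
Proof.
move=> t0; rewrite -chernoff_exp// EFinM.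
pose f (k : 'I_l) (s : R) : R :=
  expR (lam t * ((s - al * co z k) ^+ 2 / D)) * kap D (al * co z k) s.
have mf k : measurable_fun [set: R] (f k).
  apply: measurable_funM; last exact: measurable_kap.
  apply: measurableT_comp => //; apply: measurable_funM => //.
  apply: measurable_funM => //; apply: measurable_funX.
  exact: measurable_funB.
have f0 k s : 0 <= f k s by rewrite mulr_ge0 ?expR_ge0// ltW// kap_gt0.
rewrite -(integral_prod1 (f := f))//; last first.
  move=> k; under eq_integral do rewrite /f expR_sqr_kap// EFinM.
  rewrite ge0_integralZl//=.
  - by rewrite integral_kap ?mule1// mulr_gt0.
  - by apply/measurable_EFinP; exact: measurable_kap.
  - by move=> s _; rewrite lee_fin ltW// kap_gt0// mulr_gt0.
rewrite -ge0_integralZl//; last 2 first.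
- apply/measurable_EFinP; apply: measurable_prod => k _.
  by apply: measurableT_comp => //; exact: measurable_co.
- by move=> x _; rewrite lee_fin; exact: prodr_ge0.
apply: eq_integral => x _; rewrite -EFinM; congr EFin.
rewrite /f big_split/= -expR_sum mulrA -expRD mulrC; congr (expR _ * _).
by rewrite mulrBr addrC /dst mulr_suml mulr_sumr.
Qed.

Let c := l%:R * (ln D^-1 / 2 + de).

Let rho_exp x z : rho x z = expR (l%:R * (ln D^-1 / 2) + (nrm x / 2 - dst x z / D / 2)).
Proof.
rewrite -[LHS]lnK ?posrE// ln_prod; last by move=> k; exact: kap_gt0.
congr expR; rewrite /nrm /dst !mulr_suml -sumrB.
rewrite (_ : l%:R * _ = \sum_(k < l) (ln D^-1 / 2)); last first.
  by rewrite sumr_const card_ord mulr_natl.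
rewrite -big_split/=; apply: eq_bigr => k _; rewrite ln_kap//.
by field; rewrite gt_eqF.
Qed.

Let rho_good x z : good x z -> rho x z <= expR c.
Proof.
case/and3P => h1 h2 _; rewrite rho_exp ler_expR /c mulrDr lerD2l.
have {}h2 : l%:R * u' <= dst x z / D by rewrite ler_pdivlMr// -mulrA [u' * D]mulrC.
apply: (@le_trans _ _ (l%:R * u / 2 - l%:R * u' / 2)).
  by rewrite lerB// ler_pM2r.
by rewrite /u /u' le_eqVlt; apply/orP; left; apply/eqP; field.
Qed.

Let mmissR : jmeas (fun x z => (miss x z)%:R : R).
Proof. by apply: measurable_natrb; exact: measurable_miss. Qed.

Let rm x z : R := rho x z * (miss x z)%:R.

Let mrm : jmeas rm. Proof. exact: measurable_funM. Qed.
Let rm_ge0 x z : 0 <= rm x z. Proof. by rewrite mulr_ge0// ltW. Qed.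
Let rm_le x z : rm x z <= rho x z.
Proof. by rewrite ler_piMr ?(ltW (rho_gt0 _ _))//; case: miss. Qed.

(** Probability of a miss given [x] under the test channel, whereas [pm] is the probability of a
    miss for an independent codeword. *)
Let q1 x : R := fine (\int[mu]_z (rm x z)%:E).

Let q1_le1 x : (\int[mu]_z (rm x z)%:E <= 1)%E.
Proof.
rewrite -(integral_rho x); apply: ge0_le_integral => //.
- by move=> z _; rewrite lee_fin.
- by apply/measurable_EFinP; exact: jmeas2.
- by apply/measurable_EFinP; exact: jmeas2.
- by move=> z _; rewrite lee_fin.
Qed.

Let q1E x : ((q1 x)%:E = \int[mu]_z (rm x z)%:E)%E.
Proof.
rewrite fineK// ge0_fin_numE; first by rewrite (le_lt_trans (q1_le1 x))// ltry.
by apply: integral_ge0 => z _; rewrite lee_fin.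
Qed.

Let q1_01 x : 0 <= 1 - q1 x <= 1.
Proof.
rewrite subr_ge0 -lee_fin q1E q1_le1/= gerBl -lee_fin q1E.
by apply: integral_ge0 => z _; rewrite lee_fin.
Qed.

Let mq1 : measurable_fun setT q1.
Proof.
apply: (measurableT_comp (fine_measurable measurableT)) => //.
apply: (measurable_fun_fubini_tonelli_F (m2 := mu) (fun p : Om * Om => (rm p.1 p.2)%:E)).
  exact/measurable_EFinP.
by move=> p; rewrite lee_fin.
Qed.

Let pm := pmiss mu miss.

Let cst_int (a : R) : (\int[mu]_x a%:E = a%:E)%E.
Proof.
by rewrite integral_cst//= (_ : mu _ = 1%E) ?mule1//; exact: probability_setT.
Qed.

(** Change of measure: on good pairs the density [rho] is at most exp of [c], so an independent
    codeword is good at least exp of - [c] times as often as one drawn from the test channel. *)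
Let pm_le x : pm x <= 1 - expR (- c) * (1 - q1 x).
Proof.
have mm : measurable_fun setT (fun z => (expR c * (miss x z)%:R)%:E).
  by apply/measurable_EFinP; apply: measurable_funM => //; exact: (jmeas2 x mmissR).
have mr : measurable_fun setT (fun z => (rho x z)%:E).
  by apply/measurable_EFinP; exact: jmeas2.
have mr' : measurable_fun setT (fun z => (rm x z)%:E).
  by apply/measurable_EFinP; exact: jmeas2.
have c0 := expR_gt0 c.
have : (\int[mu]_z ((rho x z)%:E + (expR c * (miss x z)%:R)%:E) <=
        \int[mu]_z ((expR c)%:E + (rm x z)%:E))%E.
  apply: ge0_le_integral => //.
  - by move=> z _; rewrite -EFinD lee_fin addr_ge0 ?mulr_ge0// ltW.
  - exact: emeasurable_funD.
  - exact: emeasurable_funD.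
  - move=> z _; rewrite -!EFinD lee_fin /rm /miss.
    have [/rho_good gxz|_] /= := boolP (good x z); last by rewrite !mulr1 addrC.
    by rewrite !mulr0 !addr0.
rewrite ge0_integralD//; last by move=> z _; rewrite lee_fin ltW.
rewrite ge0_integralD//; last by move=> z _; rewrite lee_fin.
under [X in (_ + X <= _)%E]eq_integral do rewrite EFinM.
rewrite ge0_integralZl//; do ?[by rewrite lee_fin ltW];
  last by apply/measurable_EFinP; exact: (jmeas2 x mmissR).
rewrite integral_rho cst_int -q1E -(pmissE mu measurable_miss) -EFinM -!EFinD lee_fin -/pm.
by rewrite expRN; exact: miss_arith.
Qed.

Variable N : nat.
Hypothesis N0 : (0 < N)%N.
Let a := N%:R * expR (- c).
Let a0 : 0 < a. Proof. by rewrite mulr_gt0 ?expR_gt0// ltr0n. Qed.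

Let pmN x : pm x ^+ N <= q1 x + a^-1.
Proof.
have p0 : 0 <= pm x by exact: pmiss_ge0 measurable_miss _.
apply: (@le_trans _ _ (expR (- (expR (- c) * (1 - q1 x))) ^+ N)).
  rewrite lerXn2r ?nnegrE ?expR_ge0// (le_trans (pm_le x))//.
  exact: expR_ge1Dx.
rewrite -expRM_natl mulrN mulrA -/a (le_trans (expRN_le a0 (q1_01 x)))//.
by rewrite opprB addrCA subrr addr0.
Qed.

Let K1 := l%:R / lam u * expR (lam u * u).
Let K2 := l%:R * u.
Let e1 x := expR (lam u * (nrm x - l%:R * u)).
Let ed t x z := expR (lam t * (dst x z / D - l%:R * t)).

(** A missed [x] will be reproduced by 0, at cost [nrm x], so misses are weighted by the norm. One
    exponential for each way to fail: norm too large, distance too large, distance too small. *)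
Let nrm_miss x z : nrm x * (miss x z)%:R <= K1 * e1 x + K2 * (ed u x z + ed u' x z).
Proof.
have K1e1 : 0 <= K1 * e1 x.
  by rewrite mulr_ge0 ?expR_ge0// mulr_ge0 ?expR_ge0// divr_ge0 ?ltW.
have K20 : 0 <= K2 by rewrite mulr_ge0 ?ltW.
have ed0 t : 0 <= ed t x z by exact: expR_ge0.
rewrite /miss /good; have [nu|un] := leP (nrm x) (l%:R * u); last first.
  by rewrite /= mulr1 -[leLHS]addr0 lerD// ?le_chernoff// mulr_ge0// addr_ge0.
have [h2|h2] := leP (l%:R * (D * u')) (dst x z); last first.
  rewrite /= mulr1 (le_trans nu)// -[leLHS]add0r lerD// ler_peMr//.
  rewrite -[leLHS]add0r lerD// -[leLHS]expR0 ler_expR nmulr_rge0// subr_le0.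
  by rewrite ler_pdivrMr// -mulrA [u' * D]mulrC ltW.
have [h3|h3] := leP (dst x z) (l%:R * (D * u)); last first.
  rewrite /= mulr1 (le_trans nu)// -[leLHS]add0r lerD// ler_peMr//.
  rewrite -[leLHS]addr0 lerD// -[leLHS]expR0 ler_expR mulr_ge0 ?ltW// subr_gt0.
  by rewrite ltr_pdivlMr// -mulrA [u * D]mulrC.
by rewrite /= mulr0 addr_ge0// mulr_ge0// addr_ge0.
Qed.

(** Bounds, per symbol, the expected norm on misses under the test channel; it tends to 0 with [l]
    because [chrate] is below 1 away from 1. *)
Definition overshoot : R :=
  expR (lam u * u) / lam u * chrate u ^+ l + u * (chrate u ^+ l + chrate u' ^+ l).

Let med t : jmeas (ed t).
Proof.
apply: measurableT_comp => //; apply: measurable_funM => //.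
by apply: measurable_funB => //; apply: measurable_funM => //; exact: measurable_dst.
Qed.

Let me1 : measurable_fun setT e1.
Proof.
apply: measurableT_comp => //; apply: measurable_funM => //.
by apply: measurable_funB => //; exact: measurable_nrm.
Qed.

Let me1' : jmeas (fun x z => e1 x).
Proof. exact: (measurableT_comp me1 measurable_fst). Qed.

Let dint_e1 : dint mu (fun x z => rho x z * e1 x) = (chrate u ^+ l)%:E.
Proof.
rewrite -(integral_nrm_exp u0); apply: eq_integral => x _.
under eq_integral do rewrite EFinM.
rewrite ge0_integralZr//.
- by rewrite integral_rho mul1e.
- by apply/measurable_EFinP; exact: jmeas2.
- by move=> z _; rewrite lee_fin ltW.
- by rewrite lee_fin expR_ge0.
Qed.

Let dint_ed t : 0 < t -> dint mu (fun x z => rho x z * ed t x z) = (chrate t ^+ l)%:E.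
Proof.
move=> t0; rewrite dint_swap.
- by under eq_integral do rewrite integral_dst_exp//; exact: cst_int.
- exact: (measurable_funM measurable_rho (med t)).
- by move=> x z; rewrite mulr_ge0 ?expR_ge0// ltW.
Qed.

Let integral_nrm_q1 : (\int[mu]_x (nrm x * q1 x)%:E <= (l%:R * overshoot)%:E)%E.
Proof.
have K10 : 0 <= K1 by rewrite mulr_ge0 ?expR_ge0// divr_ge0 ?ltW.
have K20 : 0 <= K2 by rewrite mulr_ge0 ?ltW.
have r0 x z : 0 <= rho x z by rewrite ltW.
have ed0 t x z : 0 <= rho x z * ed t x z by rewrite mulr_ge0 ?expR_ge0.
have e10 x z : 0 <= rho x z * e1 x by rewrite mulr_ge0 ?expR_ge0.
have mred t : jmeas (fun x z => rho x z * ed t x z) by exact: (measurable_funM measurable_rho (med t)).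
have mre1 : jmeas (fun x z => rho x z * e1 x).
  exact: (measurable_funM measurable_rho me1').
have m23 : jmeas (fun x z => rho x z * ed u x z + rho x z * ed u' x z).
  exact: (measurable_funD (mred u) (mred u')).
have mK1 : jmeas (fun x z => K1 * (rho x z * e1 x)).
  exact: (measurable_funM (measurable_cst K1) mre1).
have mK2 : jmeas (fun x z => K2 * (rho x z * ed u x z + rho x z * ed u' x z)).
  exact: (measurable_funM (measurable_cst K2) m23).
apply: (@le_trans _ _ (dint mu (fun x z => nrm x * rm x z))).
  rewrite le_eqVlt; apply/orP; left; apply/eqP; apply: eq_integral => x _.
  rewrite EFinM q1E -ge0_integralZl//.
  - by apply/measurable_EFinP; exact: jmeas2.
  - by move=> z _; rewrite lee_fin.
  - by rewrite lee_fin nrm_ge0.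
apply: (@le_trans _ _ (dint mu (fun x z => K1 * (rho x z * e1 x) +
    K2 * (rho x z * ed u x z + rho x z * ed u' x z)))).
  apply: le_dint.
  - exact: (measurable_funM measurable_nrm1 mrm).
  - exact: (measurable_funD mK1 mK2).
  - move=> x z; rewrite mulr_ge0 ?nrm_ge0//=.
    apply: (@le_trans _ _ (rho x z * (K1 * e1 x + K2 * (ed u x z + ed u' x z)))).
      by rewrite /rm mulrCA; apply: ler_wpM2l.
    by rewrite le_eqVlt; apply/orP; left; apply/eqP; ring.
rewrite dintD//; last 2 first.
- by move=> x z; rewrite mulr_ge0.
- by move=> x z; rewrite mulr_ge0// addr_ge0.
rewrite dintZl// dintZl//; last by move=> x z; rewrite addr_ge0.
rewrite dintD// dint_e1 !dint_ed//.
rewrite -[X in (X + _)%E]EFinM -[X in (K2%:E * X)%E]EFinD -EFinM -EFinD lee_fin.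
by rewrite le_eqVlt; apply/orP; left; apply/eqP; rewrite /K1 /K2 /overshoot; field; rewrite gt_eqF.
Qed.

Lemma exists_codebook : exists2 s : seq Om, size s = N &
  (\int[mu]_x (nrm x * \prod_(z <- s) (miss x z)%:R)%:E <=
   (l%:R * (overshoot + (N%:R * expR (- (l%:R * (ln D^-1 / 2 + de))))^-1))%:E)%E.
Proof.
have [s ss hs] := exists_codewords mu measurable_miss N measurable_nrm nrm_ge0.
exists s => //; apply: (le_trans hs).
have mnq : measurable_fun setT (fun x => (nrm x * q1 x)%:E).
  by apply/measurable_EFinP; apply: measurable_funM => //; exact: measurable_nrm.
have mna : measurable_fun setT (fun x => (a^-1 * nrm x)%:E).
  by apply/measurable_EFinP; apply: measurable_funM => //; exact: measurable_nrm.
have q0 x : 0 <= q1 x by have /andP[_] := q1_01 x; rewrite gerBl.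
have aV : 0 <= a^-1 by rewrite invr_ge0 ltW.
apply: (@le_trans _ _ (\int[mu]_x ((nrm x * q1 x)%:E + (a^-1 * nrm x)%:E))%E).
  apply: ge0_le_integral => //.
  - move=> x _; rewrite lee_fin mulr_ge0 ?nrm_ge0// exprn_ge0//.
    exact: pmiss_ge0 measurable_miss _.
  - apply/measurable_EFinP; apply: measurable_funM; first exact: measurable_nrm.
    by apply: measurable_funX; exact: measurable_pmiss measurable_miss.
  - exact: emeasurable_funD.
  - move=> x _; rewrite -EFinD lee_fin [a^-1 * _]mulrC -mulrDr.
    by rewrite ler_wpM2l ?nrm_ge0//; exact: pmN.
rewrite ge0_integralD//; last 2 first.
- by move=> x _; rewrite lee_fin mulr_ge0// nrm_ge0.
- by move=> x _; rewrite lee_fin mulr_ge0// nrm_ge0.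
rewrite mulrDr EFinD leeD//.
under eq_integral do rewrite EFinM.
rewrite ge0_integralZl//.
- by rewrite integral_nrm -EFinM mulrC.
- by apply/measurable_EFinP; exact: measurable_nrm.
- by move=> x _; rewrite lee_fin nrm_ge0.
Qed.

End Quantizer.

(** * A Gaussian quantizer *)

Lemma cvg_overshoot (R : realType) (de : R) : 0 < de -> de < 1 ->
  (fun l => overshoot l de) @ \oo --> (0 : R).
Proof.
move=> de0 de1.
have c1 : (fun l => chrate (1 + de) ^+ l) @ \oo --> (0 : R).
  apply: cvg_expr; rewrite ger0_norm ?chrate_ge0//.
  by apply: chrate_lt1; [rewrite addr_gt0|rewrite -subr_eq0 addrC addKr gt_eqF].
have c2 : (fun l => chrate (1 - de) ^+ l) @ \oo --> (0 : R).
  apply: cvg_expr; rewrite ger0_norm ?chrate_ge0//.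
  by apply: chrate_lt1; [rewrite subr_gt0|rewrite -subr_eq0 addrC addKr oppr_eq0 gt_eqF].
rewrite /overshoot.
set A := _ / _.
rewrite (_ : 0 = A * 0 + (1 + de) * (0 + 0)); last by rewrite addr0 !mulr0 addr0.
apply: cvgD; first exact: cvgMr.
by apply: cvgMr; exact: cvgD.
Qed.

Lemma measurable_find d (T : measurableType d) (U : Type) (g : T -> U -> bool)
    (s : seq U) (j : nat) :
  (forall z, measurable_fun setT (g^~ z)) -> measurable [set x | find (g x) s = j].
Proof.
move=> mg; elim: s j => [|z s IH] [|j] /=.
- by rewrite (_ : [set _ | _] = setT)//; apply/seteqP; split.
- by rewrite (_ : [set _ | _] = set0)//; apply/seteqP; split.
- rewrite (_ : [set _ | _] = g^~ z @^-1` [set true]).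
    by rewrite -[X in measurable X]setTI; exact: mg.
  by apply/seteqP; split => x /=; case: (g x z).
- rewrite (_ : [set _ | _] = g^~ z @^-1` [set false] `&` [set x | find (g x) s = j]).
    by apply: measurableI => //; rewrite -[X in measurable X]setTI; exact: mg.
  by apply/seteqP; split => x /=; [case: (g x z) => // -[->]|case=> -> ->].
Qed.

Section Encoder.
Context {R : realType} (l : nat).
Local Notation Om := (#|'I_l|.-tuple R).
Variables (D de : R) (s : seq Om).
Hypotheses (D0 : 0 < D) (de0 : 0 < de).
Let N := size s.

(** The first good codeword is chosen. The extra cell, of index [N], means that there is none, and
    [qword] then falls back on the default of [nth], the zero vector. *)
Definition qcell (x : Om) : 'I_N.+1 := inord (find (good D de x) s).

Definition qword (j : 'I_N.+1) : Om :=
  nth (tup (fun=> 0)) [seq tup (fun k => Num.sqrt (1 - D) * co z k) | z <- s] j.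

Lemma measurable_qcell j : measurable (qcell @^-1` [set j]).
Proof.
rewrite (_ : _ @^-1` _ = [set x | find (good D de x) s = j]).
  apply: measurable_find => z.
  rewrite (_ : good D de ^~ z = fun x => ~~ miss D de x z); last first.
    by apply/funext => x; rewrite /miss negbK.
  apply: measurable_neg.
  exact: (measurableT_comp (measurable_miss D de) (measurable_pair2 z)).
apply/seteqP; split => x /=; first by move=> <-; rewrite inordK// ltnS find_size.
by move=> h; apply: val_inj; rewrite /= inordK// ltnS -/N find_size.
Qed.

Lemma qcell_dist x :
  \sum_(k < l) (co x k - co (qword (qcell x)) k) ^+ 2 <=
  l%:R * (D * (1 + de)) + nrm x * \prod_(z <- s) (miss D de x z)%:R.
Proof.
have fs : (find (good D de x) s < N.+1)%N by rewrite ltnS find_size.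
have [hs|hs] := boolP (has (good D de x) s).
  have := nth_find (tup (fun=> 0)) hs; set z := nth _ _ _ => gz.
  have -> : qword (qcell x) = tup (fun k => Num.sqrt (1 - D) * co z k).
    by rewrite /qword /qcell inordK// (nth_map (tup (fun=> 0)))// -has_find.
  under [leLHS]eq_bigr do rewrite co_tup.
  case/and3P : gz => _ _ h; apply: le_trans h _.
  by rewrite lerDl mulr_ge0 ?nrm_ge0// prodr_ge0.
have -> : qword (qcell x) = tup (fun=> 0).
  by rewrite /qword /qcell inordK// hasNfind// nth_default// size_map.
under [leLHS]eq_bigr do rewrite co_tup subr0.
rewrite (_ : \prod_(z <- s) _ = 1) ?mulr1; last first.
  rewrite big_seq big1// => z zs.
  by rewrite /miss (negbTE (hasPn hs z zs)).
by rewrite -/(nrm x) lerDr !mulr_ge0 ?ler0n ?ltW// addr_gt0.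
Qed.

End Encoder.

Lemma leq_add3 a b c l : (a + b + c <= l)%N -> [/\ a <= l, b <= l & c <= l]%N.
Proof. by move=> h; split; lia. Qed.

Lemma inv_mul_le (R : realFieldType) (l de e : R) : 0 < l -> 0 < de -> 0 < e ->
  (de * e)^-1 <= l -> (l * de)^-1 <= e.
Proof.
move=> l0 de0 e0; rewrite -div1r ler_pdivrMr ?mulr_gt0// => h.
by rewrite -div1r ler_pdivrMr ?mulr_gt0// mulrC -mulrA.
Qed.

Lemma le_add2_mul3 (R : realFieldType) (a b : R) : a <= b -> 1 <= b -> a + 1 + 1 <= 3 * b.
Proof. lra. Qed.

Lemma rate_arith (R : realFieldType) (t l h de eps : R) :
  0 < l -> de <= eps / 4 -> t <= l * (eps / 2) ->
  t + (l * (h + de) + l * de) <= l * (h + eps).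
Proof.
move=> l0 hd ht; have : l * de <= l * (eps / 4) by rewrite ler_pM2l.
rewrite !mulrDr; lra.
Qed.

Lemma dist_arith (R : realFieldType) (D de v w eps : R) : 0 < eps ->
  D * de <= eps / 4 -> v <= eps / 4 -> w <= eps / 4 ->
  D * (1 + de) + (v + w) <= D + eps.
Proof. rewrite mulrDr mulr1; lra. Qed.

Lemma quantizer (R : realType) (D eps : R) : 0 < D -> D <= 1 -> 0 < eps ->
  exists L : nat, forall l : nat, (L <= l)%N ->
  forall mu : probability (#|'I_l|.-tuple R) R, gaussian mu ->
  exists (N : nat) (J : #|'I_l|.-tuple R -> 'I_N.+1) (cb : 'I_N.+1 -> #|'I_l|.-tuple R),
  [/\ forall j, measurable (J @^-1` [set j]),
      ln (N.+1)%:R <= l%:R * (ln D^-1 / 2 + eps) &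
      (\int[mu]_x (\sum_(k < l) (co x k - co (cb (J x)) k) ^+ 2)%:E <=
       (l%:R * (D + eps))%:E)%E].
Proof.
move=> D0 D1 eps0.
(* A quarter of [eps] because the distortion is a sum of [D] and three errors and the rate uses [de]
   twice; the minimum with 1 ensures that [de] is below 1. *)
pose de := Num.min eps 1 / 4.
have min0 : 0 < Num.min eps 1 by rewrite lt_min eps0 ltr01.
have de0 : 0 < de by rewrite divr_gt0.
have de_eps : de <= eps / 4 by rewrite ler_pM2r// ge_min lexx.
have de1 : de < 1.
  rewrite ltr_pdivrMr// mul1r; apply: (@le_lt_trans _ _ 1); first by rewrite ge_min lexx orbT.
  by rewrite ltr1n.
have e4 : 0 < eps / 4 by rewrite divr_gt0.
have [L1 _ hL1] : \forall l \near \oo, overshoot l de < eps / 4.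
  have /cvgrPdist_lt/(_ _ e4) := cvg_overshoot de0 de1.
  apply: filterS => l; rewrite sub0r normrN; exact: le_lt_trans (ler_norm _).
pose L2 := (Num.truncn ((de * (eps / 4))^-1)).+1.
pose L3 := (Num.truncn (ln 3 / (eps / 2))).+1.
exists (L1 + L2 + L3)%N => l lL mu gmu.
have [hl1 hl2 hl3] := leq_add3 lL.
have l0 : (0 < l)%N by exact: leq_trans hl2.
have lR0 : 0 < l%:R :> R by rewrite ltr0n.
have ov : overshoot l de < eps / 4 by exact: hL1.
have l2 : (de * (eps / 4))^-1 <= l%:R.
  apply: (@le_trans _ _ L2%:R); last by rewrite ler_nat.
  by rewrite ltW// truncnS_gt.
have l3 : ln 3 / (eps / 2) <= l%:R.
  apply: (@le_trans _ _ L3%:R); last by rewrite ler_nat.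
  by rewrite ltW// truncnS_gt.
have lnD : 0 <= ln D^-1 by rewrite ln_ge0// invf_ge1.
pose c := l%:R * (ln D^-1 / 2 + de).
(* The surplus l de over [c] makes the expected number of hits at least exp(l de) >= l de, so its
   inverse is small. The two roundings up give at most 3 E cells, and [L3] absorbs ln 3. *)
pose E := expR (c + l%:R * de).
have E1 : 1 <= E.
  by rewrite -expR0 ler_expR addr_ge0// mulr_ge0 ?ler0n// ?addr_ge0 ?divr_ge0// ltW.
pose N := (Num.truncn E).+1.
have EN : E <= N%:R by rewrite ltW// truncnS_gt.
have NE : N.+1%:R <= 3 * E.
  by rewrite /N -natr1 -natr1 le_add2_mul3// truncn_le expR_ge0.
have [s ss hs] := exists_codebook gmu l0 D0 D1 de0 de1 (ltn0Sn (Num.truncn E)).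
exists (size s), (qcell D de s), (@qword R l D s); split.
- exact: measurable_qcell.
- rewrite ss; apply: (@le_trans _ _ (ln (3 * E))).
    by rewrite ler_ln ?posrE// mulr_gt0// expR_gt0.
  rewrite lnM ?posrE ?expR_gt0// expRK /c; apply: rate_arith => //.
  by rewrite -ler_pdivrMr// divr_gt0.
have mnm : measurable_fun setT
    (fun x => (nrm x * \prod_(z <- s) (miss D de x z)%:R)%:E).
  apply/measurable_EFinP; apply: measurable_funM; first exact: measurable_nrm.
  apply: measurable_prod => z _; exact: (measurable_miss1 (measurable_miss D de) z).
apply: (@le_trans _ _ (\int[mu]_x ((l%:R * (D * (1 + de)))%:E +
    (nrm x * \prod_(z <- s) (miss D de x z)%:R)%:E))%E).
  apply: ge0_le_integral => //.
  - by move=> x _; rewrite lee_fin; apply: sumr_ge0 => k _; exact: sqr_ge0.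
  - apply/measurable_EFinP; apply: measurable_sum => k; apply: measurable_funX.
    apply: measurable_funB; first exact: measurable_co.
    exact: (measurable_fun_switch (@measurable_qcell _ _ D de s)
      (fun j => measurable_cst (co (@qword R l D s j) k))).
  - exact: emeasurable_funD.
  - by move=> x _; rewrite -EFinD lee_fin; exact: qcell_dist.
have Dde : 0 <= l%:R * (D * (1 + de)).
  by rewrite !mulr_ge0 ?ler0n ?addr_ge0// ltW.
rewrite ge0_integralD//; last by move=> x _; rewrite lee_fin mulr_ge0 ?nrm_ge0// prodr_ge0.
rewrite integral_cst//= (_ : mu _ = 1%E) ?mule1; last exact: probability_setT.
apply: (le_trans (leeD2l _ hs)); rewrite -EFinD lee_fin -mulrDr ler_pM2l//.
rewrite -/N -/c; set a := N%:R * expR (- c).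
have a_ge : l%:R * de <= a.
  apply: (@le_trans _ _ (expR (l%:R * de))).
    by apply: le_trans (expR_ge1Dx _); rewrite lerDr.
  rewrite (_ : l%:R * de = (c + l%:R * de) - c); last by rewrite addrC addKr.
  by rewrite expRD ler_pM2r ?expR_gt0.
have aV : a^-1 <= eps / 4.
  have lde : 0 < l%:R * de by rewrite mulr_gt0.
  apply: (@le_trans _ _ (l%:R * de)^-1); first by rewrite lef_pV2// posrE (lt_le_trans lde).
  exact: inv_mul_le.
have Dd : D * de <= eps / 4.
  by apply: le_trans de_eps; rewrite ler_piMl// ltW.
by apply: dist_arith => //; exact: ltW.
Qed.

(** * The coding scheme *)

Section FiniteCode.
Context d (T : measurableType d) (I : finType) (k : nat) (J : I -> T -> 'I_k).
Hypothesis mJ : forall p j, measurable (J p @^-1` [set j]).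

(** A finite vector of cells takes finitely many values, so any condition on it gives a finite union
    of measurable sets. This settles encoder and decoders at once. *)
Lemma measurable_code (A : set {ffun I -> 'I_k}) :
  measurable [set x | A [ffun p => J p x]].
Proof.
rewrite (_ : [set _ | _] = \big[setU/set0]_(f : {ffun I -> 'I_k} | `[< A f >])
    \bigcap_(p in [set` enum I]) (J p @^-1` [set f p])).
  by apply: bigsetU_measurable => f _; apply: fin_bigcap_measurable.
rewrite -bigcup_seq_cond; apply/seteqP; split => x /=.
  move=> Ax; exists [ffun p => J p x]; first by rewrite /= mem_index_enum; apply/asboolP.
  by move=> p _ /=; rewrite ffunE.
case=> f /= /andP[_ /asboolP Af] fx; rewrite (_ : [ffun p => J p x] = f)//.
by apply/ffunP => p; rewrite ffunE; apply: fx; rewrite /= mem_enum.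
Qed.

End FiniteCode.

Section Scheme.
Context {R : realType} {d : measure_display} {T : measurableType d}.
Variables (P : probability T R) (m : nat) (X : 'I_m -> nat -> T -> R).
Hypothesis sX : iid_std_gaussian_source P X.
Variables (n l N : nat).
Hypothesis ll : (l + l <= n)%N.
Local Notation Om := (#|'I_l|.-tuple R).
Variables (J : Om -> 'I_N.+1) (cb : 'I_N.+1 -> Om).
Hypothesis mJ : forall j, measurable (J @^-1` [set j]).

(* [h = false] is the first half of the block, [h = true] the second one. *)
Let pos_subproof (h : bool) (k : 'I_l) : (h * l + k < n)%N.
Proof. by have := ltn_ord k; case: h; lia. Qed.

Let pos h k : 'I_n := Ordinal (pos_subproof h k).

Let half (U : Type) (f : U -> R) (h : bool) (x : n.-tuple U) : Om :=
  tup (fun k => f (tnth x (pos h k))).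

Let srcJ (p : 'I_m * bool) (x : n.-tuple (m.-tuple R)) : 'I_N.+1 :=
  J (half (fun y => tnth y p.1) p.2 x).

(* The message of the edge [i, i + 1]: either endpoint can subtract the cell of
   the other one, which it knows. *)
Let edge (f : {ffun 'I_m * bool -> 'I_N.+1}) : {ffun 'I_m -> 'I_N.+1} :=
  [ffun i => f (i, false) + f (ordS i, true)].

Let enc (x : n.-tuple (m.-tuple R)) : 'I_#|{ffun 'I_m -> 'I_N.+1}| :=
  enum_rank (edge [ffun p => srcJ p x]).

(** Decoder i only needs the first half of node i - 1 and the second half of node i + 1: these are
    the summands that mask its own cells on its two edges. *)
Let sideJ (h : bool) (y : n.-tuple (R * R)) : 'I_N.+1 :=
  J (half (if h then snd else fst) h y).

(** Positions beyond both halves are reproduced by 0, at cost 1 each, the variance of the source. *)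
Let word (a b : 'I_N.+1) (k : nat) : R :=
  if insub k is Some k' then co (cb a) k'
  else if insub (k - l)%N is Some k' then co (cb b) k' else 0.

Let decf (i : 'I_m) (v : 'I_#|{ffun 'I_m -> 'I_N.+1}|) (f : {ffun bool -> 'I_N.+1}) :
    n.-tuple R :=
  [tuple word (enum_val v i - f true) (enum_val v (ord_pred i) - f false) k | k < n].

Let dec i v (y : n.-tuple (R * R)) : n.-tuple R := decf i v [ffun h => sideJ h y].

Let measurable_half d' (U : measurableType d') (f : U -> R) h :
  measurable_fun setT f -> measurable_fun setT (half f h).
Proof.
move=> mf; apply: (measurable_tup (F := fun k x => f (tnth x (pos h k)))) => k.
exact: (measurableT_comp mf (measurable_tnth _)).
Qed.

Let msrcJ p j : measurable (srcJ p @^-1` [set j]).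
Proof.
have mh := measurable_half p.2 (measurable_tnth p.1).
by rewrite -[X in measurable X]setTI; exact: (mh measurableT _ (mJ j)).
Qed.

Let msideJ h j : measurable (sideJ h @^-1` [set j]).
Proof.
have mh : measurable_fun setT (half (if h then snd else fst : R * R -> R) h).
  by apply: measurable_half; case: h.
by rewrite -[X in measurable X]setTI; exact: (mh measurableT _ (mJ j)).
Qed.

Let menc j : measurable (enc @^-1` [set j]).
Proof. exact: (measurable_code msrcJ [set f | enum_rank (edge f) = j]). Qed.

Let mdec i v : measurable_fun setT (dec i v).
Proof.
move=> _ Y mY; rewrite setTI.
exact: (measurable_code msideJ [set f | Y (decf i v f)]).
Qed.

Let g (i : 'I_m) (h : bool) (k : 'I_l) : 'I_m * nat := (i, h * l + k)%N.

Let injg i h : injective (g i h).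
Proof. by move=> k k' [/addnI/val_inj]. Qed.

Let cell i h w := J (family X (g i h) w).

Let srcJE p w : srcJ p (src_block X n w) = cell p.1 p.2 w.
Proof.
by congr J; apply: co_inj => k; rewrite !co_tup !tnth_mktuple.
Qed.

Let sideJE i h w : sideJ h (side_block X i n w) =
  cell (if h then ordS i else ord_pred i) h w.
Proof.
by congr J; apply: co_inj => k; rewrite !co_tup !tnth_mktuple; case: h.
Qed.

Let decE i w k : tnth (dec i (enc (src_block X n w)) (side_block X i n w)) k =
  word (cell i false w) (cell i true w) k.
Proof.
rewrite tnth_mktuple /enc enum_rankK !ffunE !sideJE !srcJE /= ord_predK.
by rewrite addrK [X in X - _]addrC addrK.
Qed.

Variables (mu : probability Om R) (V : R).
Hypothesis gmu : gaussian mu.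
Hypothesis hV :
  (\int[mu]_x (\sum_(k < l) (co x k - co (cb (J x)) k) ^+ 2)%:E <= (l%:R * V)%:E)%E.

Let merr k : measurable_fun setT (fun x : Om => (co x k - co (cb (J x)) k) ^+ 2).
Proof.
apply: measurable_funX; apply: measurable_funB; first exact: measurable_co.
exact: (measurable_fun_switch mJ (fun j => measurable_cst (co (cb j) k))).
Qed.

Let half_err (i : 'I_m) (h : bool) :
  (\sum_(k < l) \int[P]_w ((X i (h * l + k)%N w - co (cb (cell i h w)) k) ^+ 2)%:E <=
   (l%:R * V)%:E)%E.
Proof.
apply: le_trans hV; rewrite integral_sumE//; last by move=> k x; exact: sqr_ge0.
rewrite le_eqVlt; apply/orP; left; apply/eqP; apply: eq_bigr => k _.
rewrite -(integral_family sX (@injg i h) gmu)//.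
- by apply: eq_integral => w _; rewrite co_tup.
- exact/measurable_EFinP.
- by move=> x; rewrite lee_fin sqr_ge0.
Qed.

Let integral_X2 i k : (\int[P]_w (X i k w ^+ 2)%:E = 1)%E.
Proof.
pose g1 (_ : unit) : 'I_m * nat := (i, k).
have ig1 : injective g1 by case=> -[].
have [nu gnu] := exists_gaussian sX ig1.
have mq : measurable_fun [set: R] (fun t : R => (t ^+ 2)%:E).
  by apply/measurable_EFinP; exact: measurable_funX.
have := integral_family sX ig1 gnu (f := fun x => (co x tt ^+ 2)%:E)
  (measurableT_comp mq (measurable_co tt)).
under eq_integral do rewrite co_tup.
move=> -> => [|x]; last by rewrite lee_fin sqr_ge0.
rewrite -integral_sqr; apply: (integral_co gnu tt mq).
by move=> t; rewrite lee_fin sqr_ge0.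
Qed.

Lemma scheme_mse (i : 'I_m) :
  (\sum_(k < n) \int[P]_w
     ((X i (val k) w - tnth (dec i (enc (src_block X n w)) (side_block X i n w)) k) ^+ 2)%:E
   <= (l%:R * V + l%:R * V + (n - l - l)%:R)%:E)%E.
Proof.
pose F k : \bar R :=
  (\int[P]_w ((X i k w - word (cell i false w) (cell i true w) k) ^+ 2)%:E)%E.
under eq_bigr => k _ do under eq_integral do rewrite decE.
rewrite -(big_mkord predT F).
rewrite (@big_cat_nat _ _ _ (l + l)%N)//= (@big_cat_nat _ _ _ l)//=; last exact: leq_addr.
rewrite !EFinD; apply: leeD; first apply: leeD.
- rewrite big_mkord; apply: le_trans (half_err i false); apply: lee_sum => k _.
  by rewrite /F /word; under eq_integral do rewrite valK.
- rewrite -{1}[l]add0n big_addn addnK big_mkord.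
  apply: le_trans (half_err i true); apply: lee_sum => k _.
  rewrite /F /word mul1n addnC; under eq_integral.
    move=> w _; rewrite insubF; last by rewrite ltnNge leq_addr.
    rewrite addKn valK; over.
  by [].
- rewrite big_nat (eq_bigr (fun=> 1%:E)) -?big_nat; last first.
    move=> k /andP[kl kn]; rewrite -(integral_X2 i k) /F /word.
    apply: eq_integral => w _; rewrite insubF; last by lia.
    by rewrite insubF ?subr0//; lia.
  rewrite sumEFin lee_fin big_const_nat iter_addr_0 -subnDA.
  by rewrite subnDA.
Qed.

Lemma scheme_good (r W : R) : (0 < n)%N ->
  m%:R * ln (N.+1)%:R / n%:R <= r ->
  l%:R * V + l%:R * V + (n - l - l)%:R <= n%:R * W -> good_code P X n r W.
Proof.
move=> n0 hr hW.
exists #|{ffun 'I_m -> 'I_N.+1}|, enc, dec; split; [exact: menc|split; [exact: mdec|split]].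
  by rewrite card_ffun !card_ord natrX lnXn ?ltr0n// -[ln _ *+ m]mulr_natl.
move=> i; rewrite /mse lee_pdivrMl ?ltr0n// -EFinM.
by apply: le_trans (scheme_mse i) _; rewrite lee_fin.
Qed.

End Scheme.

Lemma half_rate_arith (R : realFieldType) (m' n' l' L h e : R) : 0 < m' -> 0 < n' -> 0 <= h -> 0 < e ->
  l' + l' <= n' -> L <= l' * (h / 2 + e / m') ->
  m' * L / n' <= m' / 4 * h + e.
Proof.
move=> m0 n0 h0 e0 ln hL; rewrite ler_pdivrMr//.
apply: (@le_trans _ _ (m' * (l' * (h / 2 + e / m')))); first by rewrite ler_pM2l.
apply: (@le_trans _ _ (m' * (n' / 2 * (h / 2 + e / m')))).
  rewrite ler_pM2l// ler_pM2r; first by rewrite ler_pdivlMr// mulr_natr mulr2n.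
  by rewrite ltr_wpDl ?divr_ge0// divr_gt0.
rewrite (_ : m' * _ = (m' / 4 * h + e / 2) * n'); last by field; rewrite gt_eqF.
by rewrite ler_pM2r// lerD2l ler_pdivrMr// ler_peMr ?ler1n// ltW.
Qed.

Lemma half_dist_arith (R : realFieldType) (m' n' l' V' e r : R) : 2 <= m' -> 0 < e -> 0 <= V' ->
  l' + l' <= n' -> r <= 1 -> 2 / e <= n' ->
  l' * (V' + e / m') + l' * (V' + e / m') + r <= n' * (V' + e).
Proof.
move=> m0 e0 V0 ln r1 hn.
have em : e / m' <= e / 2 by rewrite ler_pM2l// lef_pV2 ?posrE// (lt_le_trans _ m0).
have em0 : 0 < e / m' by rewrite divr_gt0// (lt_le_trans _ m0).
have n1 : 1 <= n' * (e / 2).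
  by rewrite mulrA ler_pdivlMr// mul1r -ler_pdivrMr.
rewrite -mulrDl; apply: (@le_trans _ _ (n' * (V' + e / m') + n' * (e / 2))).
  by apply: lerD; [rewrite ler_pM2r// ltr_wpDl|exact: le_trans n1].
rewrite -mulrDr ler_wpM2l//; last by rewrite -addrA lerD2l; lra.
by apply: le_trans hn; rewrite divr_ge0// ltW.
Qed.

Section Cycle.
Context {R : realType} {d : measure_display} {T : measurableType d}.
Variables (P : probability T R) (m : nat) (X : 'I_m -> nat -> T -> R) (D : R).
Hypothesis sX : iid_std_gaussian_source P X.
Hypotheses (m2 : (1 < m)%N) (D0 : 0 < D) (D1 : D <= 1).

Lemma achievable_rate : achievable P X D (m%:R / 4 * ln D^-1).
Proof.
move=> eps eps0.
have mR : 2 <= m%:R :> R by rewrite ler_nat.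
have mR0 : 0 < m%:R :> R by exact: lt_le_trans mR.
(* The m edge messages add up their excess rates, so each quantizer gets a share eps / m of the
   slack. *)
have em0 : 0 < eps / m%:R by rewrite divr_gt0.
have [L hL] := quantizer D0 D1 em0.
(* An odd block leaves one unquantized symbol of distortion 1; this makes it at most n eps / 2. *)
pose L2 := (Num.truncn (2 / eps)).+1.
exists (L + L + L2)%N => n nL; pose l := n./2.
have ll : (l + l <= n)%N by rewrite /l addnn -{2}(odd_double_half n) leq_addl.
have [n0 Ll nL2] : [/\ (0 < n)%N, (L <= l)%N & (L2 <= n)%N].
  rewrite /l; split; first by rewrite (leq_trans _ nL)// addnS.
    by rewrite geq_half_double -addnn (leq_trans _ nL)// leq_addr.
  by rewrite (leq_trans _ nL)// leq_addl.
(* Any node will do: it only serves to produce a Gaussian law on [l] coordinates. *)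
pose i0 : 'I_m := Ordinal (ltnW m2).
pose g (k : 'I_l) : 'I_m * nat := (i0, val k).
have ig : injective g by move=> k k' [/val_inj].
have [mu gmu] := exists_gaussian sX ig.
have [N [J [cb [mJ hN hV]]]] := hL l Ll mu gmu.
have lln : l%:R + l%:R <= n%:R :> R by rewrite -natrD ler_nat.
apply: (scheme_good sX ll mJ gmu hV n0).
  apply: half_rate_arith hN => //; first by rewrite ltr0n.
  by rewrite ln_ge0// invf_ge1.
apply: half_dist_arith => //; first exact: ltW.
  by rewrite -subnDA addnn /l -{1}(odd_double_half n) addnK lern1 leq_b1.
by rewrite (le_trans (ltW (truncnS_gt _)))// ler_nat.
Qed.

End Cycle.

(** * Letting the slack tend to zero *)

Lemma le_of_slack (R : realFieldType) (v r c : R) : 0 < c ->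
  (forall e, 0 < e -> v <= r + c * e) -> v <= r.
Proof.
move=> c0 h; rewrite leNgt; apply/negP => rv.
have : 0 < (v - r) / (2 * c) by rewrite divr_gt0 ?mulr_gt0// subr_gt0.
move=> /h; rewrite (_ : c * _ = (v - r) / 2); last by field; rewrite gt_eqF.
by move: rv; lra.
Qed.

Lemma converse_rate (R : realType) (d : measure_display) (T : measurableType d)
  (P : probability T R) (m : nat) (X : 'I_m -> nat -> T -> R) (D r : R) :
  (5 <= m)%N -> odd m -> iid_std_gaussian_source P X -> 0 < D ->
  achievable P X D r -> m%:R / 4 * ln D^-1 <= r.
Proof.
move=> m5 om sX D0 ach.
have [K mE] : exists K, m = K.*2.+1.+4.
  by exists ((m - 5)./2); move: m5 om; clear; lia.
subst m; set m := K.*2.+1.+4 in X sX ach m5 om *.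
have key eps : 0 < eps -> m%:R / 4 * ln (D + eps)^-1 <= r + eps.
  move=> eps0; have [N hN] := ach _ eps0.
  (* The length [N.+1] rather than [N], so that it is positive. *)
  have [M [enc [dec [menc [mdec [hr hd]]]]]] := hN N.+1 (leqnSn N).
  pose g (p : 'I_m * 'I_N.+1) : 'I_m * nat := (p.1, val p.2).
  have ig : injective g by move=> [i k] [i' k'] [-> /val_inj ->].
  have [mu gmu] := exists_gaussian sX ig.
  have V0 : 0 < D + eps by rewrite addr_gt0.
  have := converse_bound sX (ltn0Sn N) V0 menc mdec hd gmu.
  move=> h; apply: le_trans hr; rewrite ler_pdivlMr ?ltr0n//.
  have E4 (a b c : R) : 4 * (a / 4 * b * c) = a * c * b by field.
  by rewrite -(@ler_pM2l _ 4)// E4.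
have lnDe e : 0 < e -> ln D^-1 - e / D <= ln (D + e)^-1.
  move=> e0; rewrite !lnV ?posrE ?addr_gt0//.
  rewrite (_ : D + e = D * (1 + e / D)); last by field; rewrite gt_eqF.
  have De : 0 < e / D by rewrite divr_gt0.
  rewrite lnM ?posrE ?addr_gt0// opprD lerD2l lerN2 le_ln1Dx//.
  by rewrite (lt_trans _ De)// oppr_lt0.
(* The slack e enters once through the rate and m / (4 D) times through the distortion, as ln(1 + e
   / D) <= e / D. *)
apply: (@le_of_slack _ _ _ (1 + m%:R / 4 / D)); first by rewrite addr_gt0// !divr_gt0.
move=> e e0; apply: (@le_trans _ _ (m%:R / 4 * ln (D + e)^-1 + m%:R / 4 / D * e)).
  rewrite -lerBlDr (_ : _ - _ = m%:R / 4 * (ln D^-1 - e / D)); last by field; rewrite gt_eqF.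
  by rewrite ler_pM2l ?divr_gt0// lnDe.
by rewrite [X in _ <= _ + X]mulrDl mul1r addrA lerD2r key.
Qed.

Theorem theorem11 (R : realType) (d : measure_display) (T : measurableType d)
  (P : probability T R) (m : nat) (X : 'I_m -> nat -> T -> R) (D : R) :
  (5 <= m)%N -> odd m ->
  iid_std_gaussian_source P X ->
  0 < D -> D <= 1 ->
  RIG P X D = (m%:R / 4) * ln (D^-1).
Proof.
move=> m5 om sX D0 D1; rewrite /RIG.
have lb : lbound [set r : R | achievable P X D r] (m%:R / 4 * ln D^-1).
  by move=> r /=; exact: converse_rate.
have a : achievable P X D (m%:R / 4 * ln D^-1).
  by apply: achievable_rate => //; exact: leq_trans m5.
apply/eqP; rewrite eq_le; apply/andP; split.
  by apply: ge_inf => //; exists (m%:R / 4 * ln D^-1).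
by apply: lb_le_inf => //; exists (m%:R / 4 * ln D^-1).
Qed.
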